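(* Let $\mathcal{F}^\omega$ and $\mathcal{G}^\nu$ be weighted combinatorial species with $\mathcal{G}[\emptyset]=\emptyset$, with $[z^k]\mathcal{F}^\omega(z)>0$ for at least one $k\ge 1$, and such that $(\mathcal{F}^\omega\circ\mathcal{G}^\nu)(z)$ is not a polynomial. Suppose that there are integers $d\ge1$ and $0\le m<d$ such that $\mathcal{G}^\nu(z)/z^m$ belongs to the class $\mathscr{S}_d$, let $\rho$ be the radius of convergence of $\mathcal{G}^\nu(z)$, and suppose that $\mathcal{F}^\omega(z)$ has radius of convergence strictly larger than $\mathcal{G}^\nu(\rho)$. Let $D=d/\gcd(m,d)$ and for each $0\le a<D$ let $\mathcal{F}_a^\omega$ denote the restriction of $\mathcal{F}^\omega$ to objects whose size lies in $a+D\mathbb{Z}$. Let $\mathsf{R}_n$ be the remainder obtained by deleting a uniformly chosen largest component from the random composite structure $\mathsf{S}_n$ drawn from $(\mathcal{F}\circ\mathcal{G})[n]$ with probability proportional to its weight (see context). Let $0\le a<D$. If the exponential generating series $\mathcal{F}_a^\omega(z)$ is not constant, then $$d_{\mathrm{TV}}(\mathsf{R}_n,\mathsf{R}(a))\to0\qquad\text{as } n\to\infty,\ n\equiv am\bmod d,$$ where $\mathsf{R}(a)$ is a random element of $\mathscr{U}((\mathcal{F}_a)'\circ\mathcal{G})$ with the Boltzmann distribution $$\mathbb{P}(\mathsf{R}(a)=R)=\mu(R)\,\frac{\rho^{|R|}}{|R|!}\,\Big((\mathcal{F}_a')^\omega(\mathcal{G}^\nu(\rho))\Big)^{-1},$$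 $\mu$ being the weighting of $(\mathcal{F}_a')^\omega\circ\mathcal{G}^\nu$.
   Context: Class $\mathscr{S}_d$ ($d\ge1$ an integer): a power series $g(z)=\sum_{n\ge0}g_nz^n$ with non-negative coefficients and radius of convergence $\rho>0$ belongs to $\mathscr{S}_d$ if $g_n=0$ whenever $d\nmid n$, and, as $n\to\infty$ with $n\equiv0\bmod d$, $g_n/g_{n+d}\to\rho^d$ and $\frac1{g_n}\sum_{i+j=n}g_ig_j\to2g(\rho)<\infty$. Weighted species: a weighted species $\mathcal{F}^\omega$ assigns to each finite set $U$ a finite set $\mathcal{F}[U]$ of structures with a weight function $\omega:\mathcal{F}[U]\to\mathbb{R}_{\ge0}$, and to each bijection $\sigma:U\to V$ a weight-preserving bijection $\mathcal{F}[\sigma]:\mathcal{F}[U]\to\mathcal{F}[V]$, functorially (identities go to identities, compositions to compositions); moreover $\mathcal{F}[U]\cap\mathcal{F}[V]=\emptyset$ for $U\neq V$. For $F\in\mathcal{F}[U]$ its size is $|F|=|U|$. Write $[n]=\{1,\dots,n\}$, $\mathcal{F}[n]=\mathcal{F}[[n]]$, $\mathscr{U}(\mathcal{F})=\bigcup_{n\ge0}\mathcal{F}[n]$. Exponential generating series: $\mathcal{F}^\omega(z)=\sum_{F\in\mathscr{U}(\mathcal{F})}\omega(F)z^{|F|}/|F|!$. Composition: if $\mathcal{G}[\emptyset]=\emptyset$, then $(\mathcal{F}\circ\mathcal{G})[U]=\bigcup_\pi\mathcal{F}[\pi]\times\prod_{Q\in\pi}\mathcal{G}[Q]$, with $\pi$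 ranging over all partitions of $U$ into non-empty classes; the weight of $(F,(G_Q)_{Q\in\pi})$ is $\omega(F)\prod_{Q\in\pi}\nu(G_Q)$. A bijection $\sigma:U\to V$ acts by transporting the partition, $F$ (along $Q\mapsto\sigma(Q)$), and each $G_Q$ (along $\sigma|_Q$). The generating series of $\mathcal{F}^\omega\circ\mathcal{G}^\nu$ is $\mathcal{F}^\omega(\mathcal{G}^\nu(z))$. Derived species: $\mathcal{F}'[U]=\mathcal{F}[U\cup\{*\}]$ with $*\notin U$ a placeholder not counted in the size; weights are inherited from $\mathcal{F}^\omega$, bijections are extended by fixing $*$. Its generating series is $(\mathcal{F}')^\omega(z)=\frac{d}{dz}\mathcal{F}^\omega(z)$. $\mathcal{F}_a'$ denotes the derived species $(\mathcal{F}_a)'$ of $\mathcal{F}_a$; $\mathscr{U}((\mathcal{F}_a)'\circ\mathcal{G})\subset\mathscr{U}(\mathcal{F}'\circ\mathcal{G})$. Remainder $\mathsf{R}_n$: for each $n$ with $[z^n](\mathcal{F}^\omega\circ\mathcal{G}^\nu)(z)>0$, let $\mathsf{S}_n=(\mathsf{F}_n,(\mathsf{G}_Q)_{Q\in\pi_n})$ be drawn from $(\mathcal{F}\circ\mathcal{G})[n]$ with probability proportional to its weight. Choose $Q_0\in\pi_n$ uniformly at random among the classes of maximal size, relabel the atom $Q_0$ of $\mathsf{F}_n$ to $*$ to obtain $\mathsf{F}_n'\in\mathcal{F}'[\pi_n\setminus\{Q_0\}]$, and let $\mathsf{R}_n\in(\mathcal{F}'\circ\mathcal{G})[n-|Q_0|]$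 be obtained from $(\mathsf{F}_n',(\mathsf{G}_Q)_{Q\in\pi_n\setminus\{Q_0\}})\in(\mathcal{F}'\circ\mathcal{G})[[n]\setminus Q_0]$ by relabelling along the unique order-preserving bijection $[n]\setminus Q_0\to[n-|Q_0|]$. Total variation distance for random variables in a countable set $S$: $d_{\mathrm{TV}}(X,Y)=\sup_{\mathcal{E}\subset S}|\mathbb{P}(X\in\mathcal{E})-\mathbb{P}(Y\in\mathcal{E})|$. *)

(* Defs.v *)
From HB Require Import structures.
From mathcomp Require Import all_boot all_order all_algebra.
From mathcomp Require Import boolp.
Set Implicit Arguments.
Unset Strict Implicit.
Unset Printing Implicit Defensive.
Import Order.TTheory GRing.Theory Num.Theory.
Local Open Scope ring_scope.

Record bij (U V : Type) := Bij {
  fwd :> U -> V;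
  bwd : V -> U;
  fwdK : cancel fwd bwd;
  bwdK : cancel bwd fwd }.

Lemma bij_ext (U V : Type) (s t : bij U V) : fwd s =1 fwd t -> s = t.
Proof.
case: s t => [f g fK gK] [f' g' fK' gK'] /= /funext e.
subst f'.
have e' : g = g' by apply/funext => y; rewrite -{1}(gK' y) fK.
by subst g'; congr Bij; exact: Prop_irrelevance.
Qed.

Lemma fwd_inj (U V : Type) (s : bij U V) : injective s.
Proof. exact: can_inj (fwdK s). Qed.

Definition bij_id (U : Type) : bij U U :=
  @Bij U U id id (fun=> erefl) (fun=> erefl).

Definition bij_comp (U V W : Type) (s : bij U V) (t : bij V W) : bij U W :=
  Bij (can_comp (fwdK t) (fwdK s)) (can_comp (bwdK s) (bwdK t)).

(* Structures on different sets are only ever collected with a tag (see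
   [all_structs]), so the disjointness of the [F[U]] needs no axiom. *)
Record wspecies (R : numDomainType) := WSpecies {
  structs :> finType -> finType;
  relabel : forall U V : finType, bij U V -> structs U -> structs V;
  weight : forall U : finType, structs U -> R;
  relabel_id : forall (U : finType) (x : structs U),
    relabel (bij_id U) x = x;
  relabel_comp : forall (U V W : finType) (s : bij U V) (t : bij V W)
    (x : structs U), relabel (bij_comp s t) x = relabel t (relabel s x);
  weight_ge0 : forall (U : finType) (x : structs U), 0 <= weight x;
  weight_relabel : forall (U V : finType) (s : bij U V) (x : structs U),
    weight (relabel s x) = weight x }.

Arguments relabel {R} w {U V}.
Arguments weight {R} w {U}.

(* A subset turned into a finite type, on which species can be evaluated. *)
Definition elts (T : finType) (A : {set T}) : finType := {x | x \in A}.

Section Bijections.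
Variables (U V : finType) (s : bij U V).

Section Sub.
Variables (A : {set U}) (B : {set V}).
Hypothesis AB : forall x, (s x \in B) = (x \in A).

Definition sub_fwd (x : elts A) : elts B :=
  exist (fun y => y \in B) (s (sval x)) (etrans (AB (sval x)) (svalP x)).

Lemma sub_bwd_subproof (y : elts B) : bwd s (sval y) \in A.
Proof. by rewrite -AB bwdK; exact: (svalP y). Qed.

Definition sub_bwd (y : elts B) : elts A :=
  exist (fun x => x \in A) (bwd s (sval y)) (sub_bwd_subproof y).

Lemma sub_fwdK : cancel sub_fwd sub_bwd.
Proof. by move=> x; apply: val_inj; rewrite /= fwdK. Qed.

Lemma sub_bwdK : cancel sub_bwd sub_fwd.
Proof. by move=> y; apply: val_inj; rewrite /= bwdK. Qed.

Definition bij_sub : bij (elts A) (elts B) := Bij sub_fwdK sub_bwdK.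
End Sub.

Lemma imset_fwdK :
  cancel (fun A : {set U} => s @: A) (fun B : {set V} => bwd s @: B).
Proof.
move=> A; rewrite -imset_comp -[RHS]imset_id; apply: eq_imset => x /=.
exact: fwdK.
Qed.

Lemma imset_bwdK :
  cancel (fun B : {set V} => bwd s @: B) (fun A : {set U} => s @: A).
Proof.
move=> A; rewrite -imset_comp -[RHS]imset_id; apply: eq_imset => x /=.
exact: bwdK.
Qed.

Definition bij_set : bij {set U} {set V} := Bij imset_fwdK imset_bwdK.

Lemma mem_bij_set (P : {set {set U}}) (A : {set U}) :
  (bij_set A \in [set s @: (B : {set U}) | B in P]) = (A \in P).
Proof. by rewrite (mem_imset _ _ (@fwd_inj _ _ bij_set)). Qed.

Lemma mem_bwd (B : {set V}) (x : U) : (s x \in B) = (x \in bwd s @: B).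
Proof. by rewrite -{2}(fwdK s x) (mem_imset _ _ (can_inj (bwdK s))). Qed.

Lemma partition_bij (P : {set {set U}}) :
  partition P [set: U] ->
  partition [set s @: (B : {set U}) | B in P] [set: V].
Proof.
case/and3P => /eqP cP tP P0; apply/and3P; split.
- apply/eqP/setP => y; rewrite inE; apply/bigcupP.
  have : bwd s y \in cover P by rewrite cP inE.
  case/bigcupP => B BP yB; exists (s @: B); first exact: imset_f.
  by rewrite -(bwdK s y) imset_f.
- apply/trivIsetP => _ _ /imsetP[A AP ->] /imsetP[B BP ->] AB.
  rewrite imset_disjoint; last exact: fwd_inj.
  by apply: (trivIsetP tP) => //; apply: contra_neq AB => ->.
- apply: contra P0 => /imsetP[A AP /esym/eqP].
  by rewrite imset_eq0 => /eqP <-.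
Qed.
End Bijections.

Definition bij_eq (T : finType) (A B : {set T}) (AB : A = B) :
    bij (elts A) (elts B) :=
  bij_sub (s := bij_id T) (fun x => f_equal (fun C : {set T} => x \in C) (esym AB)).

Section Composition.
Variables (R : numDomainType) (F G : wspecies R).

Section Structures.
Variable U : finType.

Definition setpart := {P : {set {set U}} | partition P [set: U]}.

Definition comp_on (P : {set {set U}}) : finType :=
  (F (elts P) * {dffun forall Q : elts P, G (elts (sval Q))})%type.

Definition comp_structs : finType := {P : setpart & comp_on (sval P)}.

Definition comp_mk (P : {set {set U}}) (PU : partition P [set: U])
    (x : F (elts P)) (g : forall Q : elts P, G (elts (sval Q))) :
  comp_structs :=
  existT _ (exist _ P PU : setpart) (x, finfun g).

Definition blocks (S : comp_structs) : {set {set U}} := sval (tag S).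

Definition outer (S : comp_structs) : F (elts (blocks S)) := (tagged S).1.

Definition component (S : comp_structs) (Q : elts (blocks S)) :
  G (elts (sval Q)) := (tagged S).2 Q.

Definition comp_weight (S : comp_structs) : R :=
  weight F (outer S) * \prod_(Q : elts (blocks S)) weight G (component Q).

Lemma blocksP (S : comp_structs) : partition (blocks S) [set: U].
Proof. exact: (svalP (tag S)). Qed.

Lemma comp_eq (S S' : comp_structs) (e : blocks S = blocks S') :
  relabel F (bij_eq e) (outer S) = outer S' ->
  (forall (Q : elts (blocks S)) (Q' : elts (blocks S'))
     (eQ : sval Q = sval Q'),
     relabel G (bij_eq eQ) (component Q) = component Q') -> S = S'.
Proof.
case: S S' e => [[P PU] [x g]] [[P' PU'] [x' g']].
rewrite /blocks /outer /component /= => e; subst P'.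
rewrite (_ : bij_eq _ = bij_id _); last first.
  by apply: bij_ext => y; apply: val_inj.
rewrite relabel_id => <- gg'.
have -> : PU' = PU by exact: Prop_irrelevance.
suff -> : g = g' by [].
apply/ffunP => Q.
rewrite -(gg' Q Q erefl) (_ : bij_eq _ = bij_id _) ?relabel_id //.
by apply: bij_ext => y; apply: val_inj.
Qed.
End Structures.

Section Relabel.
Variables (U V : finType) (s : bij U V).

Definition bij_blocks (P : {set {set U}}) :
    bij (elts P) (elts [set s @: (Q : {set U}) | Q in P]) :=
  bij_sub (s := bij_set s) (mem_bij_set s P).

Definition bij_block (P : {set {set U}})
    (Q : elts [set s @: (Q : {set U}) | Q in P]) :
    bij (elts (sval (bwd (bij_blocks P) Q))) (elts (sval Q)) :=
  bij_sub (s := s) (mem_bwd s (sval Q)).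

Definition comp_relabel (S : comp_structs U) : comp_structs V :=
  comp_mk (partition_bij s (blocksP S))
    (relabel F (bij_blocks (blocks S)) (outer S))
    (fun Q => relabel G (bij_block Q) (component (bwd (bij_blocks _) Q))).
End Relabel.

Lemma component_mk (U : finType) (P : {set {set U}}) (PU : partition P [set: U])
    (x : F (elts P)) (g : forall Q : elts P, G (elts (sval Q))) (Q : elts P) :
  component (S := comp_mk PU x g) Q = g Q.
Proof. exact: ffunE. Qed.

Lemma component_eq (U : finType) (S : comp_structs U)
    (Q Q' : elts (blocks S)) (e : sval Q = sval Q') :
  component Q' = relabel G (bij_eq e) (component Q).
Proof.
have e' : Q = Q' by exact: val_inj.
subst Q'; rewrite (_ : bij_eq e = bij_id _) ?relabel_id //.
by apply: bij_ext => y; apply: val_inj.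
Qed.

Lemma comp_relabel_id (U : finType) (S : comp_structs U) :
  comp_relabel (bij_id U) S = S.
Proof.
have e : blocks (comp_relabel (bij_id U) S) = blocks S.
  rewrite /blocks /= -[RHS]imset_id; apply: eq_imset => Q; exact: imset_id.
apply: (comp_eq (e := e)).
  rewrite /outer /= -relabel_comp -[RHS]relabel_id; congr relabel.
  by apply: bij_ext => Q; apply: val_inj; rewrite /= imset_id.
move=> Q Q' eQ; rewrite component_mk -relabel_comp.
have e' : sval (bwd (bij_blocks (bij_id U) (blocks S)) Q) = sval Q'.
  by rewrite -eQ /= imset_id.
rewrite (component_eq e'); congr relabel.
by apply: bij_ext => y; apply: val_inj.
Qed.

Lemma comp_relabel_comp (U V W : finType) (s : bij U V) (t : bij V W)
    (S : comp_structs U) :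
  comp_relabel (bij_comp s t) S = comp_relabel t (comp_relabel s S).
Proof.
have e : blocks (comp_relabel (bij_comp s t) S) =
    blocks (comp_relabel t (comp_relabel s S)).
  by rewrite /blocks /= -imset_comp; apply: eq_imset => Q; exact: imset_comp.
apply: (comp_eq (e := e)).
  rewrite /outer /= -!relabel_comp; congr relabel.
  by apply: bij_ext => Q; apply: val_inj; rewrite /= imset_comp.
move=> Q Q' eQ; rewrite !component_mk -!relabel_comp.
set Q1 := bwd _ _; set Q2 := bwd _ (bwd _ _).
have e' : sval Q1 = sval Q2 by rewrite /= eQ imset_comp.
rewrite (component_eq e') -relabel_comp; congr relabel.
by apply: bij_ext => y; apply: val_inj.
Qed.

Lemma comp_weight_ge0 (U : finType) (S : comp_structs U) : 0 <= comp_weight S.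
Proof.
apply: mulr_ge0; first exact: weight_ge0.
by apply: prodr_ge0 => Q _; exact: weight_ge0.
Qed.

Lemma comp_weight_relabel (U V : finType) (s : bij U V) (S : comp_structs U) :
  comp_weight (comp_relabel s S) = comp_weight S.
Proof.
rewrite /comp_weight /outer /= weight_relabel; congr (_ * _).
rewrite (reindex (bij_blocks s (blocks S))) /=; last first.
  apply: onW_bij; exists (bwd (bij_blocks s (blocks S))); first exact: fwdK.
  exact: bwdK.
apply: eq_bigr => Q _; rewrite component_mk weight_relabel.
have e : sval Q = sval (bwd (bij_blocks s (blocks S)) (bij_blocks s (blocks S) Q)).
  by rewrite fwdK.
by rewrite (component_eq e) weight_relabel.
Qed.

Definition species_comp : wspecies R :=
  WSpecies comp_relabel_id comp_relabel_comp comp_weight_ge0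
    comp_weight_relabel.
End Composition.

Section BijOption.
Variables (U V : Type) (s : bij U V).

Lemma bij_option_fwdK : cancel (omap s) (omap (bwd s)).
Proof. by case=> //= x; rewrite fwdK. Qed.

Lemma bij_option_bwdK : cancel (omap (bwd s)) (omap s).
Proof. by case=> //= x; rewrite bwdK. Qed.

Definition bij_option : bij (option U) (option V) :=
  Bij bij_option_fwdK bij_option_bwdK.
End BijOption.

(* [None] is the placeholder atom. *)
Section Derivative.
Variables (R : numDomainType) (F : wspecies R).

Definition deriv_structs (U : finType) : finType := F (option U).

Definition deriv_relabel (U V : finType) (s : bij U V)
    (x : deriv_structs U) : deriv_structs V :=
  relabel F (bij_option s) x.

Definition deriv_weight (U : finType) (x : deriv_structs U) : R := weight F x.

Lemma deriv_relabel_id (U : finType) (x : deriv_structs U) :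
  deriv_relabel (bij_id U) x = x.
Proof.
rewrite -[RHS](relabel_id (w := F)); congr relabel.
by apply: bij_ext; case.
Qed.

Lemma deriv_relabel_comp (U V W : finType) (s : bij U V) (t : bij V W)
    (x : deriv_structs U) :
  deriv_relabel (bij_comp s t) x = deriv_relabel t (deriv_relabel s x).
Proof.
rewrite /deriv_relabel -relabel_comp; congr relabel.
by apply: bij_ext; case.
Qed.

Lemma deriv_weight_ge0 (U : finType) (x : deriv_structs U) :
  0 <= deriv_weight x.
Proof. exact: weight_ge0. Qed.

Lemma deriv_weight_relabel (U V : finType) (s : bij U V)
    (x : deriv_structs U) : deriv_weight (deriv_relabel s x) = deriv_weight x.
Proof. exact: weight_relabel. Qed.

Definition species_deriv : wspecies R :=
  WSpecies deriv_relabel_id deriv_relabel_comp deriv_weight_ge0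
    deriv_weight_relabel.
End Derivative.

Lemma bij_card (U V : finType) (s : bij U V) : #|V| = #|U|.
Proof.
by symmetry; apply: bij_eq_card; exists (bwd s); [exact: fwdK|exact: bwdK].
Qed.

Section Restriction.
Variables (R : numDomainType) (F : wspecies R) (D a : nat).

Definition restr_structs (U : finType) : finType :=
  {x : F U | #|U| == a %[mod D]}.

Lemma restr_subproof (U V : finType) (s : bij U V) (x : restr_structs U) :
  #|V| == a %[mod D].
Proof. by rewrite (bij_card s); exact: (svalP x). Qed.

Definition restr_relabel (U V : finType) (s : bij U V)
    (x : restr_structs U) : restr_structs V :=
  exist _ (relabel F s (sval x)) (restr_subproof s x).

Definition restr_weight (U : finType) (x : restr_structs U) : R :=
  weight F (sval x).

Lemma restr_relabel_id (U : finType) (x : restr_structs U) :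
  restr_relabel (bij_id U) x = x.
Proof. by apply: val_inj; exact: relabel_id. Qed.

Lemma restr_relabel_comp (U V W : finType) (s : bij U V) (t : bij V W)
    (x : restr_structs U) :
  restr_relabel (bij_comp s t) x = restr_relabel t (restr_relabel s x).
Proof. by apply: val_inj; exact: relabel_comp. Qed.

Lemma restr_weight_ge0 (U : finType) (x : restr_structs U) :
  0 <= restr_weight x.
Proof. exact: weight_ge0. Qed.

Lemma restr_weight_relabel (U V : finType) (s : bij U V)
    (x : restr_structs U) : restr_weight (restr_relabel s x) = restr_weight x.
Proof. exact: weight_relabel. Qed.

Definition species_restr : wspecies R :=
  WSpecies restr_relabel_id restr_relabel_comp restr_weight_ge0
    restr_weight_relabel.
End Restriction.

(* Removing the block [Q]: [rest] is the complement [U \ Q], and [bij_rest]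
   sends the atom [Q] to the placeholder [None]. *)
Section DeleteBlock.
Variables (U : finType) (P : {set {set U}}) (PU : partition P [set: U]).
Variable Q : elts P.

Definition rest : finType := elts (~: sval Q).

Definition rest_blocks : {set {set rest}} :=
  [set B : {set rest} | [set sval x | x in B] \in P].

Lemma rest_inj : injective (fun x : rest => sval x).
Proof. exact: val_inj. Qed.

Lemma rest_imsetK (B : {set rest}) :
  [set x : rest | sval x \in [set sval y | y in B]] = B.
Proof. by apply/setP => x; rewrite inE (mem_imset _ _ rest_inj). Qed.

Lemma rest_preimsetK (A : elts P) : A != Q ->
  [set sval x | x in [set x : rest | sval x \in sval A]] = sval A.
Proof.
move=> AQ; apply/setP => x; apply/imsetP/idP => [[y]|xA].
  by rewrite inE => yA ->.
have xQ : x \in ~: sval Q.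
  rewrite inE; apply: contra AQ => xQ; apply/eqP/val_inj/eqP => /=.
  apply: contraT => AQ.
  case/and3P: PU => _ /trivIsetP tP _.
  have /pred0P/(_ x) /= := tP _ _ (svalP A) (svalP Q) AQ.
  by rewrite xA xQ.
by exists (exist (fun x => x \in ~: sval Q) x xQ); rewrite ?inE.
Qed.

Lemma rest_neq (B : {set rest}) (BP : B \in rest_blocks) :
  [set sval x | x in B] != sval Q.
Proof.
case/and3P: PU => _ _ P0.
have := BP; rewrite inE => BP'.
have : B != set0.
  apply: contra P0 => /eqP B0.
  by move: BP'; rewrite B0 imset0.
case/set0Pn => x xB; apply/eqP => /setP/(_ (sval x)).
have := svalP x; rewrite inE => /negPf ->.
by rewrite imset_f.
Qed.

Lemma partition_rest : partition rest_blocks [set: rest].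
Proof.
case/and3P: (PU) => /eqP cP /trivIsetP tP P0; apply/and3P; split.
- apply/eqP/setP => x; rewrite inE; apply/bigcupP.
  have : sval x \in cover P by rewrite cP inE.
  case/bigcupP => A AP xA.
  have AQ : exist (fun A => A \in P) A AP != Q.
    apply: contraTneq xA => AQ.
    have -> : A = sval Q by rewrite -AQ.
    by have := svalP x; rewrite inE.
  exists [set x : rest | sval x \in A]; last by rewrite inE.
  by rewrite inE (rest_preimsetK AQ).
- apply/trivIsetP => A B; rewrite !inE => AP BP AB.
  rewrite -(imset_disjoint rest_inj).
  apply: tP => //; apply: contra_neq AB => AB.
  by rewrite -(rest_imsetK A) AB rest_imsetK.
- by apply: contra P0; rewrite inE imset0.
Qed.

Definition unrest (A : option (elts rest_blocks)) : elts P :=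
  if A is Some B then exist (fun C => C \in P) [set sval x | x in sval B]
    (etrans (esym (in_set _ _)) (svalP B)) else Q.

Definition torest (A : elts P) : option (elts rest_blocks) :=
  if A == Q then None else insub [set x : rest | sval x \in sval A].

Lemma torestK : cancel torest unrest.
Proof.
rewrite /torest => A; case: eqVneq => [->//|AQ].
case: insubP => [B _ BE|].
  by apply: val_inj; rewrite /= [sval B]BE rest_preimsetK.
by rewrite inE rest_preimsetK // (svalP A).
Qed.

Lemma unrestK : cancel unrest torest.
Proof.
rewrite /torest => -[B|] /=; last by rewrite eqxx.
rewrite -val_eqE /= (negPf (rest_neq (svalP B))) rest_imsetK.
by rewrite valK.
Qed.

Definition bij_rest : bij (elts P) (option (elts rest_blocks)) :=
  Bij torestK unrestK.

Section RestBlock.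
Variable B : {set rest}.

Lemma rest_fwd_subproof (x : elts [set sval y | y in B]) :
  sval x \in ~: sval Q.
Proof. by case: x => _ /= /imsetP[y _ ->]; exact: (svalP y). Qed.

Lemma rest_fwd_subproof2 (x : elts [set sval y | y in B]) :
  exist (fun z => z \in ~: sval Q) (sval x) (rest_fwd_subproof x) \in B.
Proof.
case/imsetP: (svalP x) => y yB e.
by rewrite (_ : exist _ _ _ = y) //; exact: val_inj.
Qed.

Definition rest_fwd (x : elts [set sval y | y in B]) : elts B :=
  exist (fun z => z \in B) _ (rest_fwd_subproof2 x).

Definition rest_bwd (y : elts B) : elts [set sval y | y in B] :=
  exist (fun z => z \in [set sval y | y in B]) (sval (sval y))
    (imset_f (fun x : rest => sval x) (svalP y)).

Lemma rest_fwdK : cancel rest_fwd rest_bwd.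
Proof. by move=> x; apply: val_inj. Qed.

Lemma rest_bwdK : cancel rest_bwd rest_fwd.
Proof. by move=> y; apply: val_inj; apply: val_inj. Qed.

Definition bij_rest_block : bij (elts [set sval y | y in B]) (elts B) :=
  Bij rest_fwdK rest_bwdK.
End RestBlock.
End DeleteBlock.

(* The unique order-preserving bijection from [[n] \ A] to [[n - |A|]]. *)
Section OrderPreserving.
Variables (n : nat) (A : {set 'I_n}).

Definition rank (x : elts (~: A)) : nat :=
  #|[set y in ~: A | (y < sval x)%N]|.

Lemma ltn_rank (x y : elts (~: A)) :
  (sval x < sval y)%N -> (rank x < rank y)%N.
Proof.
move=> xy; apply: proper_card; apply/properP; split.
  apply/subsetP => z; rewrite !inE => /andP[-> zx] /=.
  exact: ltn_trans zx xy.
exists (sval x); first by have := svalP x; rewrite !inE => ->.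
by rewrite !inE ltnn andbF.
Qed.

Lemma rank_lt (x : elts (~: A)) : (rank x < n - #|A|)%N.
Proof.
have -> : (n - #|A| = #|~: A|)%N by rewrite (cardsCs (~: A)) setCK card_ord.
apply: proper_card; apply/properP; split.
  by apply/subsetP => z; rewrite !inE => /andP[].
by exists (sval x); rewrite ?(svalP x) // !inE ltnn andbF.
Qed.

Definition ord_rank (x : elts (~: A)) : 'I_(n - #|A|) := Ordinal (rank_lt x).

Lemma ord_rank_inj : injective ord_rank.
Proof.
move=> x y [] xy; apply/val_inj/val_inj => /=.
by case: (ltngtP (sval x) (sval y)) => // /ltn_rank; rewrite xy ltnn.
Qed.

Lemma ord_rank_onto (k : 'I_(n - #|A|)) : k \in codom ord_rank.
Proof.
apply: inj_card_onto; first exact: ord_rank_inj.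
rewrite card_ord card_sub -[X in (_ <= X)%N]/#|~: A|.
by rewrite (cardsCs (~: A)) setCK card_ord.
Qed.

Lemma ord_rankK : cancel ord_rank (fun k => iinv (ord_rank_onto k)).
Proof. by move=> x; apply: ord_rank_inj; rewrite f_iinv. Qed.

Lemma ord_unrankK : cancel (fun k => iinv (ord_rank_onto k)) ord_rank.
Proof. by move=> k; rewrite f_iinv. Qed.

Definition bij_order : bij (elts (~: A)) 'I_(n - #|A|) :=
  Bij ord_rankK ord_unrankK.
End OrderPreserving.

(* [{1, ..., n}] is represented by ['I_n]. *)
Definition all_structs (R : numDomainType) (F : wspecies R) : choiceType :=
  {n : nat & F 'I_n}.

Section Remainder.
Variables (R : numDomainType) (F G : wspecies R).

Definition delete_block (U : finType) (S : species_comp F G U)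
    (Q : elts (blocks S)) : species_comp (species_deriv F) G (rest Q) :=
  comp_mk (F := species_deriv F) (partition_rest (blocksP S) Q)
    (relabel F (bij_rest (blocksP S) Q) (outer S))
    (fun B => relabel G (bij_rest_block (sval B)) (component (unrest (Some B)))).

Definition remainder (n : nat) (S : species_comp F G 'I_n) (Q : elts (blocks S)) :
    all_structs (species_comp (species_deriv F) G) :=
  existT _ (n - #|sval Q|)%N
    (relabel (species_comp (species_deriv F) G) (bij_order (sval Q))
       (delete_block Q)).

Definition maximal_blocks (U : finType) (S : species_comp F G U) :
    {set elts (blocks S)} :=
  [set Q : elts (blocks S) |
    [forall Q' : elts (blocks S), #|sval Q'| <= #|sval Q| ]%N].

End Remainder.

From mathcomp Require Import classical_sets functions reals ereal.
From mathcomp Require Import topology normedtype sequences exp esum.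
Import numFieldNormedType.Exports.
Local Open Scope classical_set_scope.

Section PowerSeries.
Variable R : realType.
Implicit Type g : nat -> R.

Definition cvradius g : \bar R :=
  ereal_sup [set r%:E | r in [set r : R | 0 <= r /\ cvgn (pseries g r)]].

(* Only used for non-negative coefficients and arguments, where the
   extended-real series always converges, possibly to [+oo]. *)
Definition ps_eval g (r : R) : \bar R :=
  (\sum_(0 <= n <oo) (g n * r ^+ n)%:E)%E.

Definition is_polynomial g : Prop := exists p : {poly R}, forall n, g n = p`_n.

Definition is_constant g : Prop := exists c : R, forall n, g n = (c%:P)`_n.

Definition multiples (d : nat) : set nat := [set n | (d %| n)%N].

Definition classS (d : nat) g : Prop :=
  exists rho : R,
    [/\ 0 < rho,
        cvradius g = rho%:E,
        forall n, 0 <= g n &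
        forall n, ~~ (d %| n)%N -> g n = 0] /\
    [/\ g n / g (n + d)%N @[n --> within (multiples d) \oo] --> rho ^+ d,
        (ps_eval g rho < +oo)%E &
        (g n)^-1 * (\sum_(i < n.+1) g i * g (n - i)%N)
          @[n --> within (multiples d) \oo] --> 2 * fine (ps_eval g rho)].

(* [h] is the power series [g(z) / z^m]. *)
Definition is_divXn (m : nat) g (h : nat -> R) : Prop :=
  (forall n, (n < m)%N -> g n = 0) /\ (forall n, h n = g (n + m)%N).

End PowerSeries.

Section Laws.
Variable R : realType.
Implicit Types F G : wspecies R.

Definition egs F (n : nat) : R := (\sum_(x : F 'I_n) weight F x) / n`!%:R.

Definition dTV (T : Type) (P Q : set T -> \bar R) : \bar R :=
  ereal_sup (range (fun E : set T => `|P E - Q E|%E)).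

(* When the total weight of [(F o G)[n]] vanishes, so that the random
   structure does not exist, this is identically 0; it is then at distance 1
   from every probability distribution. *)
Definition remainder_law F G (n : nat)
    (E : set (all_structs (species_comp (species_deriv F) G))) : \bar R :=
  (\sum_(S : species_comp F G 'I_n)
     weight (species_comp F G) S /
     (\sum_(S' : species_comp F G 'I_n) weight (species_comp F G) S') *
     (\sum_(Q in maximal_blocks S | `[< E (remainder Q) >])
        #|maximal_blocks S|%:R^-1))%:E.

Definition restr_incl F G (D a : nat)
    (r : all_structs (species_comp (species_deriv (species_restr F D a)) G)) :
    all_structs (species_comp (species_deriv F) G) :=
  existT (fun n => species_comp (species_deriv F) G 'I_n) (tag r)
    (comp_mk (F := species_deriv F) (blocksP (tagged r))
       (sval (outer (tagged r))) (@component _ _ _ _ (tagged r))).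

Definition boltzmann F G (D a : nat) (rho : R)
    (r : all_structs (species_comp (species_deriv (species_restr F D a)) G)) : R :=
  weight (species_comp (species_deriv (species_restr F D a)) G) (tagged r) *
  (rho ^+ tag r / (tag r)`!%:R) *
  (fine (ps_eval (egs (species_deriv (species_restr F D a)))
                 (fine (ps_eval (egs G) rho))))^-1.

(* The Boltzmann distribution, seen on the larger set of
   [(F' o G)]-structures. *)
Definition boltzmann_law F G (D a : nat) (rho : R)
    (E : set (all_structs (species_comp (species_deriv F) G))) : \bar R :=
  \esum_(r in @restr_incl F G D a @^-1` E) (boltzmann rho r)%:E.

End Laws.

(* Main.v *)
(** A composite structure on [n] with a unique largest block B amounts to a
    remainder R of size n - |B|, the set B and a G-structure on B. Hence, once
    n > 2|R|, the remainder equals R with probability at least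
    mu(R)/|R|! * [z^(n-|R|)]G / [z^n]F(G). Kesten's bound on convolution powers
    of subexponential sequences dominates the coefficients of F(G) and gives
    limsup [z^n]F(G) / [z^(m+d nu)]G <= rho^(m-am) * F_a'(G(rho)) along
    n = a m + d nu, so the liminf of these probabilities is at least the
    Boltzmann weight of R. As the Boltzmann weights sum to 1, lower bounds at
    every point suffice for convergence in total variation (Scheffe). *)
Require Import Defs.
From mathcomp Require Import all_boot all_order all_algebra.
From mathcomp Require Import boolp reals ring lra.
Set Implicit Arguments.
Unset Strict Implicit.
Unset Printing Implicit Defensive.
Import Order.TTheory GRing.Theory Num.Theory.
Local Open Scope ring_scope.

(** * Convolution powers *)

(** The obstacle is periodicity. Put [G(z) = z^m h(z)] and [H n = h (d * n)]: then [G^k] is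
    [z^(k m)] times a power series in [z^d]. At degree [a m + d n] only the [k] congruent to [a]
    modulo [D] contribute, each through [[z^(n - t)] H^k] with [t = period_shift k]. This shift may
    grow linearly in [k], whereas the ratio condition controls [H (n - t) / H n] only for fixed [t].
    Kesten's bound is therefore needed uniformly in [k] and [t]. The uniform version costs a factor
    [theta > 1] for each unit of [k] and of [t]; the gap between [G(rho)] and the radius of
    convergence of [F] pays for it. The constant [rho^(m - a m)] comes from the identity
    [rho^(k m) = rho^(a m) (rho^d)^t]. *)

Section ConvolutionPowers.
Variable R : comNzRingType.
Implicit Types g h : nat -> R.

Fixpoint cpow g (k n : nat) : R :=
  if k is k'.+1 then \sum_(i < n.+1) cpow g k' i * g (n - i)%N
  else (n == 0)%:R.

Lemma cpowS g k n : cpow g k.+1 n = \sum_(i < n.+1) cpow g k i * g (n - i)%N.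
Proof. by []. Qed.

(** Coefficients below [N] only see the truncation of [g] at [N], so identities between powers of
    series reduce to identities between polynomials. *)
Lemma cpow_poly g N k n : (n < N)%N ->
  cpow g k n = ((\poly_(i < N) g i) ^+ k)`_n.
Proof.
elim: k n => [|k IH] n nN; first by rewrite expr0 coef1.
rewrite exprSr coefM cpowS; apply: eq_bigr => i _.
rewrite IH ?(leq_ltn_trans _ nN) ?leq_ord// coef_poly.
by rewrite (leq_ltn_trans (leq_subr _ _) nN).
Qed.

Lemma cpow_shift g h m k n :
  (forall i, (i < m)%N -> g i = 0) -> (forall i, h i = g (i + m)%N) ->
  cpow g k n = if (n < k * m)%N then 0 else cpow h k (n - k * m).
Proof.
move=> g0 hg; set N := n.+1.
have e : \poly_(i < m + N) g i = 'X^m * \poly_(i < N) h i.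
  apply/polyP => i; rewrite coefXnM !coef_poly; case: (ltnP i m) => im.
    by rewrite g0 // if_same.
  by rewrite hg subnK // ltn_subLR.
rewrite (@cpow_poly _ (m + N)) ?ltn_addl// e exprMn_comm; last exact: mulrC.
rewrite -exprM coefXnM mulnC; case: ltnP => // nk.
by rewrite (@cpow_poly _ N) // ltnS leq_subr.
Qed.

Lemma poly_dilate h d n : (0 < d)%N -> (forall i, ~~ (d %| i)%N -> h i = 0) ->
  \poly_(i < d * n) h i = (\poly_(i < n) h (d * i)%N) \Po 'X^d.
Proof.
move=> d0 hd; apply/polyP => i; rewrite coef_comp_poly_Xn // !coef_poly ltn_divLR //.
rewrite [(n * d)%N]mulnC; case: ifP => [iN|]; case: dvdnP => //.
- by move=> [j ->]; rewrite mulnK // mulnC.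
- by move/dvdnP; exact: hd.
Qed.

Lemma cpow_dilate h d k n : (0 < d)%N -> (forall i, ~~ (d %| i)%N -> h i = 0) ->
  cpow h k n =
    if (d %| n)%N then cpow (fun i => h (d * i)%N) k (n %/ d) else 0.
Proof.
move=> d0 hd; set N := n.+1.
rewrite (@cpow_poly _ (d * N)) ?leq_pmull// poly_dilate //.
have -> (p : {poly R}) : (p \Po 'X^d) ^+ k = (p ^+ k) \Po 'X^d.
  by rewrite rmorphXn.
rewrite coef_comp_poly_Xn //; case: ifP => // _.
by rewrite (@cpow_poly _ N) // ltnS leq_div.
Qed.
End ConvolutionPowers.

Section ConvolutionPowersSum.
Variable R : numDomainType.
Variable g : nat -> R.
Hypothesis g0 : forall n, 0 <= g n.

Lemma cpow_ge0 k n : 0 <= cpow g k n.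
Proof.
elim: k n => [|k IH] n /=; first exact: ler0n.
by apply: sumr_ge0 => i _; apply: mulr_ge0.
Qed.

Lemma coef_poly_ge0 N k n : 0 <= ((\poly_(i < N) g i) ^+ k)`_n.
Proof.
elim: k n => [|k IH] n; first by rewrite expr0 coef1 ler0n.
rewrite exprSr coefM; apply: sumr_ge0 => i _; apply: mulr_ge0 => //.
by rewrite coef_poly; case: ifP.
Qed.

Lemma coef_poly_le_cpow N k n : ((\poly_(i < N) g i) ^+ k)`_n <= cpow g k n.
Proof.
elim: k n => [|k IH] n; first by rewrite expr0 coef1.
rewrite exprSr coefM cpowS; apply: ler_sum => i _.
apply: ler_pM => //; first exact: coef_poly_ge0; rewrite coef_poly; case: ifP => //.
Qed.

(** The right side evaluates a power of the truncated polynomial; its coefficients below [N] are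
    exact and the remaining ones are non-negative. *)
Lemma sum_cpow_le x N k : 0 <= x ->
  \sum_(n < N) cpow g k n * x ^+ n <= (\sum_(n < N) g n * x ^+ n) ^+ k.
Proof.
move=> x0; rewrite -(horner_poly N g x) -horner_exp.
set p := _ ^+ k; rewrite (@horner_coef_wide _ (maxn N (size p))) ?leq_maxr//.
rewrite -(big_mkord xpredT (fun n => p`_n * x ^+ n)).
rewrite (@big_cat_nat _ _ _ N) ?leq_maxl//= big_mkord.
rewrite -[leLHS]addr0 lerD //; last first.
  by apply: sumr_ge0 => n _; rewrite mulr_ge0 ?exprn_ge0 ?coef_poly_ge0.
by apply: ler_sum => n _; rewrite (@cpow_poly _ _ N).
Qed.

(** The converse bound: the power of the truncation has degree at most [k * N], and truncating [g]
    can only lower its coefficients. *)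
Lemma le_sum_cpow x N k : 0 <= x ->
  (\sum_(n < N) g n * x ^+ n) ^+ k <= \sum_(n < (k * N).+1) cpow g k n * x ^+ n.
Proof.
move=> x0; rewrite -(horner_poly N g x) -horner_exp (@horner_coef_wide _ (k * N).+1).
  by apply: ler_sum => n _; rewrite ler_wpM2r ?exprn_ge0 ?coef_poly_le_cpow.
apply: leq_trans (size_poly_exp_leq _ _) _; rewrite ltnS mulnC leq_mul2l.
by rewrite (leq_trans (leq_pred _)) ?size_poly ?orbT.
Qed.
End ConvolutionPowersSum.

(** * The exponential formula for weighted set partitions *)

Section PartitionSums.
Variables (R : numFieldType) (T : finType) (g : nat -> R).
Hypothesis g00 : g 0%N = 0.

Lemma sum_subsets_card (phi : nat -> R) (A : {set T}) :
  \sum_(B : {set T} | B \subset A) phi #|B| =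
  \sum_(i < #|A|.+1) 'C(#|A|, i)%:R * phi i.
Proof.
rewrite (partition_big (fun B : {set T} => inord #|B| : 'I_#|A|.+1) xpredT) //=.
apply: eq_bigr => i _; rewrite -(cards_draws A i) -[X in X%:R]sum1_card natr_sum mulr_suml.
apply: eq_big => [B|B /andP[BA /eqP <-]]; last first.
  by rewrite mul1r inordK // ltnS subset_leq_card.
rewrite !inE; case BA: (B \subset A) => //=.
by rewrite -val_eqE /= inordK // ltnS subset_leq_card.
Qed.

Definition part_sum k (A : {set T}) : R :=
  \sum_(P : {set {set T}} | partition P A && (#|P| == k))
    \prod_(B in P) (g #|B| * #|B|`!%:R).

Lemma part_sum0 A : part_sum 0 A = (#|A| == 0%N)%:R.
Proof.
rewrite /part_sum cards_eq0; case: eqVneq => [->|A0] /=.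
  rewrite (big_pred1 set0) ?big_set0 // => P.
  rewrite cards_eq0 /=; apply/andP/eqP => [[_ /eqP//]|->]; split=> //.
  by rewrite partition_set0.
rewrite big_pred0 // => P; rewrite cards_eq0; apply/negbTE/negP.
case/andP => /and3P[/eqP cA _ _] /eqP P0; move: A0.
by rewrite -cA P0 /cover big_set0 eqxx.
Qed.

(* Both sides count the partitions with a distinguished block B. *)
Lemma part_sumS k A :
  k.+1%:R * part_sum k.+1 A =
  \sum_(B : {set T} | B \subset A)
     g #|B| * #|B|`!%:R * part_sum k (A :\: B).
Proof.
rewrite mulr_sumr.
under eq_bigr => P /andP[_ /eqP <-] do
  rewrite mulr_natl -sumr_const.
rewrite (exchange_big_dep
  (fun B : {set T} => (B \subset A) && (B != set0))) /=; last first.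
  move=> P B /andP[/and3P[/eqP <- _ P0] _] BP.
  by rewrite (bigcup_max B) //=; apply: contraNneq P0 => <-.
rewrite [RHS](bigD1 set0) ?sub0set //= cards0 g00 !mul0r add0r.
apply: eq_bigr => B /andP[BA B0].
rewrite /part_sum mulr_sumr.
rewrite (reindex_onto (fun P : {set {set T}} => B |: P) (fun P => P :\ B)) /=;
  last by move=> P /andP[_ BP]; rewrite setD1K.
have BnP P : partition P (A :\: B) -> B \notin P.
  case/and3P => /eqP cP _ _; apply/negP => BP.
  have : B \subset A :\: B by rewrite -cP (bigcup_max B).
  by rewrite subsetD -setI_eq0 setIid (negbTE B0) andbF.
apply: eq_big => [P|P /andP[_ /eqP eP]]; last first.
  have BP : B \notin P by rewrite -eP !inE eqxx.
  by rewrite big_setU1.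
apply/andP/andP => [[/andP[/andP[pA cP] _] /eqP eP]|[pA cP]].
  have BP : B \notin P by rewrite -eP !inE eqxx.
  split; first by rewrite -eP partitionD1 // setU11.
  by move: cP; rewrite cardsU1 BP add1n eqSS.
have BP := BnP _ pA.
rewrite setU1K // eqxx setU11 cardsU1 BP add1n eqSS cP !andbT; split=> //.
rewrite -{1}(setID A B) (setIidPr BA) partitionU1 //.
by rewrite disjoint_sym disjoints_subset setDE subsetIr.
Qed.

(** Induction on the number of blocks: the binomial coefficient that counts the choices of the
    distinguished block cancels against the factorials, and [part_sumS] becomes a Cauchy product. *)
Lemma part_sumE k A :
  part_sum k A = #|A|`!%:R / k`!%:R * cpow g k #|A|.
Proof.
elim: k A => [|k IH] A.
  rewrite part_sum0 /= fact0 divr1; case: eqP => [->|_]; last by rewrite mulr0.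
  by rewrite mulr1.
have k0 : k.+1%:R != 0 :> R by rewrite pnatr_eq0.
apply: (mulfI k0).
rewrite part_sumS.
under eq_bigr => B BA.
  rewrite IH cardsD (setIidPr BA); over.
rewrite (sum_subsets_card (fun i => g i * i`!%:R *
  ((#|A| - i)`!%:R / k`!%:R * cpow g k (#|A| - i)))).
(* The left side is indexed by the size of the distinguished block, [cpowS] by the size of what
   remains; reversing the index matches them. *)
rewrite cpowS !mulr_sumr (reindex_inj rev_ord_inj) /=.
apply: eq_bigr => i _; rewrite subSS.
have iA : (i <= #|A|)%N by rewrite -ltnS.
rewrite subKn // bin_sub // -(bin_fact iA) factS !natrM.
by field; rewrite -(natrD _ 1 k) !pnatr_eq0 -lt0n fact_gt0.
Qed.
End PartitionSums.

(** * Generating series of composite species *)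

Section CompositionSeries.
Variable R : realType.
Implicit Types F G : wspecies R.

Lemma sum_weight_bij F (U V : finType) (s : bij U V) :
  \sum_(x : F U) weight F x = \sum_(x : F V) weight F x.
Proof.
rewrite [RHS](reindex (relabel F s)) /=.
  by apply: eq_bigr => x _; rewrite weight_relabel.
exists (relabel F (Bij (bwdK s) (fwdK s))) => x _.
  rewrite -relabel_comp -[RHS]relabel_id; congr relabel.
  by apply: bij_ext => y /=; rewrite fwdK.
rewrite -relabel_comp -[RHS]relabel_id; congr relabel.
by apply: bij_ext => y /=; rewrite bwdK.
Qed.

Definition bij_enum_rank (U : finType) : bij U 'I_#|U| :=
  Bij (@enum_rankK U) (@enum_valK U).

Lemma sum_weight_egs F (U : finType) :
  \sum_(x : F U) weight F x = egs F #|U| * #|U|`!%:R.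
Proof.
rewrite (sum_weight_bij F (bij_enum_rank U)) /egs divfK //.
by rewrite pnatr_eq0 -lt0n fact_gt0.
Qed.

Lemma egs_ge0 F n : 0 <= egs F n.
Proof.
by rewrite /egs divr_ge0 ?ler0n // sumr_ge0 // => x _; exact: weight_ge0.
Qed.

Lemma card_elts (T : finType) (A : {set T}) : #|elts A| = #|A|.
Proof. by rewrite card_sig; apply: eq_card => x; rewrite inE. Qed.

(** Distributivity for dependent functions: in [fprod] each value carries its index as a tag, which
    reduces the claim to the non-dependent exchange of sum and product. *)
Lemma sum_prod_dffun (I : finType) (T : I -> finType)
    (E : forall i, T i -> R) :
  \sum_(f : {dffun forall i, T i}) \prod_i E i (f i) =
  \prod_i \sum_(x : T i) E i x.
Proof.
rewrite (reindex (@dffun_of_fprod I T)) /=; last first.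
  exact/onW_bij/dffun_of_fprod_bij.
pose P i := [ffun x => E i x].
transitivity (\sum_(t : fprod T) \prod_(i in I) P i (t i)).
  by apply: eq_bigr => t _; apply: eq_bigr => i _; rewrite !ffunE.
rewrite big_fprod -(bigA_distr_big_dep _ (fun i => untag 0 (P i))).
apply: eq_bigr => i _; apply: etrans (esym (big_tag (fun i x => P i x) i)) _.
by apply: eq_bigr => x _; rewrite ffunE.
Qed.

Lemma sum_weight_comp F G (U : finType) :
  \sum_(S : species_comp F G U) weight (species_comp F G) S =
  \sum_(P : {set {set U}} | partition P [set: U])
    egs F #|P| * #|P|`!%:R * \prod_(Q in P) (egs G #|Q| * #|Q|`!%:R).
Proof.
rewrite (big_sub (fun P : {set {set U}} => partition P [set: U])).
pose w (P : setpart U) (x : comp_on F G (sval P)) : R :=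
  weight (species_comp F G) (existT _ P x : comp_structs F G U).
transitivity (\sum_(P : setpart U) \sum_(x : comp_on F G (sval P)) w P x).
  by rewrite sig_big_dep; apply: eq_bigr => -[].
apply: eq_bigr => P _.
have -> : \prod_(Q in sval P) (egs G #|Q| * #|Q|`!%:R) =
    \prod_(Q : elts (sval P)) \sum_(x : G (elts (sval Q))) weight G x.
  rewrite (big_sub (mem (sval P))); apply: eq_bigr => Q _.
  by rewrite sum_weight_egs card_elts.
rewrite -(card_elts (sval P)) -sum_weight_egs -sum_prod_dffun big_distrlr /=.
by rewrite pair_big /=; apply: eq_bigr.
Qed.

(** Partitions are grouped by their number of blocks, which is at most [n] because blocks are
    non-empty; the exponential formula evaluates each group. *)
Lemma egs_species_comp F G n : egs G 0 = 0 ->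
  egs (species_comp F G) n = \sum_(k < n.+1) egs F k * cpow (egs G) k n.
Proof.
move=> G0; rewrite {1}/egs sum_weight_comp.
have cn (P : {set {set 'I_n}}) : partition P [set: 'I_n] -> (#|P| < n.+1)%N.
  move=> pP; rewrite ltnS -[leqRHS]card_ord -cardsT (card_partition pP).
  rewrite -sum1_card; apply: leq_sum => Q QP; rewrite card_gt0.
  by case/and3P: pP => _ _; apply: contraNneq => <-.
rewrite (partition_big (fun P : {set {set 'I_n}} => inord #|P| : 'I_n.+1)
  xpredT) //= mulr_suml; apply: eq_bigr => k _.
have nf j : j`!%:R != 0 :> R by rewrite pnatr_eq0 -lt0n fact_gt0.
transitivity (egs F k * k`!%:R * part_sum (egs G) k [set: 'I_n] / n`!%:R); last first.
  by rewrite part_sumE // cardsT card_ord; field; rewrite !nf.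
congr (_ / _); rewrite /part_sum mulr_sumr; apply: eq_big => P.
  case pP: (partition _ _) => //=.
  by rewrite -val_eqE /= inordK // cn.
case/andP => pP /eqP e; congr (egs F _ * _`!%:R * _).
  by rewrite -e inordK // cn.
by rewrite -e inordK // cn.
Qed.
End CompositionSeries.

(** * Gluing a largest block *)

Section DerivativeRestriction.
Variables (R : realType) (F : wspecies R).

Lemma egs_deriv n : egs (species_deriv F) n = n.+1%:R * egs F n.+1.
Proof.
rewrite {1}/egs (sum_weight_egs F (option 'I_n)) card_option card_ord factS natrM.
by field; rewrite pnatr_eq0 -lt0n fact_gt0.
Qed.

Lemma egs_restr D a n :
  egs (species_restr F D a) n = if n == a %[mod D] then egs F n else 0.
Proof.
rewrite /egs; case: ifP => na; last first.
  rewrite big1 ?mul0r // => x _; suff: n == a %[mod D] by rewrite na.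
  by case: x => _; rewrite card_ord.
congr (_ / _).
rewrite (reindex (fun x : species_restr F D a 'I_n => sval x)) /=; first exact: eq_bigr.
have nD : #|'I_n| == a %[mod D] by rewrite card_ord.
by exists (fun x => exist _ x nD) => // x _; exact: val_inj.
Qed.
End DerivativeRestriction.

Section Glue.
Variables (R : numDomainType) (F G : wspecies R).

Definition bij_sym (U V : Type) (s : bij U V) : bij V U := Bij (bwdK s) (fwdK s).

Lemma bij_symK (U V : finType) (s : bij U V) (H : wspecies R) :
  cancel (relabel H (bij_sym s)) (relabel H s).
Proof.
move=> x; rewrite -relabel_comp -[RHS]relabel_id; congr relabel.
by apply: bij_ext => y /=; rewrite bwdK.
Qed.

Section GlueBlock.
Variables (U : finType) (A : {set U}) (A0 : A != set0).
Variables (y : species_comp (species_deriv F) G (elts (~: A))) (gam : G (elts A)).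

Let lft (B : {set elts (~: A)}) : {set U} := [set sval x | x in B].

Let lft_sub B : lft B \subset ~: A.
Proof. by apply/subsetP => _ /imsetP[x _ ->]; exact: svalP x. Qed.

Let lft_inj : injective lft.
Proof. exact: (imset_inj val_inj). Qed.

Definition glue_blocks : {set {set U}} := A |: lft @: blocks y.

Lemma glue_blocksP : partition glue_blocks [set: U].
Proof.
rewrite -(setUCr A) partitionU1 //; last by rewrite disjoints_subset setCK.
case/and3P: (blocksP y) => /eqP cy /trivIsetP ty y0; apply/and3P; split.
- rewrite /cover big_imset /=; last by move=> ? ? _ _; exact: lft_inj.
  apply/eqP/setP => x; apply/bigcupP/idP => [[B By /(subsetP (lft_sub B))//]|xA].
  have : exist _ x xA \in cover (blocks y) by rewrite cy inE.
  case/bigcupP => B By xB; exists B => //.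
  by apply/imsetP; exists (exist _ x xA).
- apply/trivIsetP => _ _ /imsetP[B By ->] /imsetP[C Cy ->] BC.
  rewrite imset_disjoint; last exact: val_inj.
  by apply: ty => //; apply: contra_neq BC => ->.
- by apply: contra y0 => /imsetP[B By /esym/eqP]; rewrite imset_eq0 => /eqP <-.
Qed.

Let AP : A \in glue_blocks. Proof. exact: setU11. Qed.

Let QA : elts glue_blocks := exist _ A AP.

Lemma glue_rest_blocks : rest_blocks QA = blocks y.
Proof.
apply/setP => B; rewrite inE in_setU1 (mem_imset _ _ lft_inj).
rewrite orbC; case By: (B \in blocks y) => //=; apply/negbTE.
apply: contra A0 => /eqP BA; rewrite -subset0; apply/subsetP => x.
move=> xA; move: (xA); rewrite -BA => xB.
by have := subsetP (lft_sub B) _ xB; rewrite inE xA.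
Qed.

(** The component of the glued structure at [C]. Its type depends on [C], so it is specified by
    transport along every possible identification of [C] with [A] or with a lifted block of [y]. The
    two cases exclude each other since a lifted block is non-empty and avoids [A]. *)
Let glue_comp (C : elts glue_blocks) : exists z : G (elts (sval C)),
  (forall e : A = sval C, z = relabel G (Defs.bij_eq e) gam) /\
  (forall (B : elts (blocks y)) (e : lft (sval B) = sval C),
     z = relabel G (Defs.bij_comp (bij_sym (bij_rest_block (Q := QA) (sval B)))
                       (Defs.bij_eq e)) (component B)).
Proof.
case: C => C /=; have lA (B : elts (blocks y)) : lft (sval B) <> A.
  move=> BA; have /= := rest_neq glue_blocksP (Q := QA) (B := sval B).
  by rewrite glue_rest_blocks => /(_ (svalP B)); rewrite [_ @: _]BA eqxx.
case/setU1P => [CA|/imsetP[B By CB]].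
- subst C; exists gam; split=> [e|B e]; last by have := lA B e.
  rewrite (_ : Defs.bij_eq e = bij_id _) ?relabel_id //.
  by apply: bij_ext => x; exact: val_inj.
- subst C; exists (relabel G (bij_sym (bij_rest_block (Q := QA) B))
    (component (exist (fun B => B \in blocks y) B By))); split=> [e|B' e].
    by have := lA (exist _ B By) (esym e).
  have eB : B = sval B' by exact/esym/lft_inj.
  rewrite (component_eq (Q := exist (fun B => B \in blocks y) B By) (Q' := B') eB).
  rewrite -relabel_comp; congr relabel; apply: bij_ext => x; exact: val_inj.
Qed.

Let outer_bij : bij (option (elts (blocks y))) (elts glue_blocks) :=
  Defs.bij_comp (bij_option (Defs.bij_eq (esym glue_rest_blocks)))
           (bij_sym (bij_rest glue_blocksP QA)).

(** Every pair of a remainder on the complement of [A] and a [G]-structure on [A] arises by deleting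
    a block. Existence is enough, as only a lower bound on probabilities will be drawn from it. *)
Lemma glue_block : exists (S : species_comp F G U) (AS : A \in blocks S),
  delete_block (exist _ A AS) = y /\
  component (exist (fun B => B \in blocks S) A AS) = gam.
Proof.
pose g C := projT1 (cid (glue_comp C)).
have gP C := projT2 (cid (glue_comp C)).
pose S : species_comp F G U :=
  comp_mk glue_blocksP (relabel F outer_bij (outer y)) g.
exists S, AP.
split; last first.
  rewrite component_mk; apply: etrans (proj1 (gP QA) erefl) _.
  rewrite (_ : Defs.bij_eq _ = bij_id _) ?relabel_id //.
  by apply: bij_ext => x; exact: val_inj.
have e : blocks (delete_block (S := S) QA) = blocks y := glue_rest_blocks.
apply: (comp_eq (e := e)).
  rewrite /outer /= /deriv_relabel -!relabel_comp -[RHS]relabel_id.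
  congr (relabel F _ _); apply: bij_ext => B.
  rewrite /= (unrestK glue_blocksP); case: B => [B|//] /=; apply: (f_equal Some).
  exact: val_inj.
move=> Q Q' eQ; rewrite !component_mk.
set C := unrest _.
have eC : lft (sval Q') = sval C by rewrite /C /= -eQ.
rewrite [g C](proj2 (gP C) Q' eC) -!relabel_comp -[RHS]relabel_id.
by congr relabel; apply: bij_ext => x; do 2!apply: val_inj.
Qed.
End GlueBlock.

Lemma weight_delete_block (U : finType) (S : species_comp F G U)
    (Q : elts (blocks S)) :
  weight (species_comp F G) S =
  weight (species_comp (species_deriv F) G) (delete_block Q) *
  weight G (component Q).
Proof.
rewrite /= /comp_weight /= /deriv_weight weight_relabel -mulrA; congr (_ * _).
rewrite (reindex (@unrest _ _ Q)) /=; last first.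
  exact/onW_bij/(Bijective (@unrestK _ _ (blocksP S) Q) (@torestK _ _ (blocksP S) Q)).
rewrite (bigD1 None) //= mulrC; congr (_ * _).
rewrite (reindex_omap Some id) /=; last by case.
rewrite (eq_bigl xpredT) => [|B]; last by rewrite eqxx.
by apply: eq_bigr => B _; rewrite component_mk weight_relabel.
Qed.
End Glue.

From mathcomp Require Import classical_sets functions cardinality fsbigop ereal.
From mathcomp Require Import topology normedtype sequences exp esum.
Import numFieldNormedType.Exports.
Local Open Scope classical_set_scope.

(** * Lower bounds for the law of the remainder *)

Section RemainderLaw.
Variables (R : realType) (F G : wspecies R).
Local Notation XT := (all_structs (species_comp (species_deriv F) G)).
Implicit Types E : set XT.

(** The real number underlying [remainder_law], so that estimates take place in [R]. *)
Definition remainder_prob (n : nat) E : R :=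
  \sum_(S : species_comp F G 'I_n)
     weight (species_comp F G) S /
     (\sum_(S' : species_comp F G 'I_n) weight (species_comp F G) S') *
     (\sum_(Q in maximal_blocks S | `[< E (remainder Q) >])
        #|maximal_blocks S|%:R^-1).

Lemma comp_prob_ge0 n (S : species_comp F G 'I_n) :
  0 <= weight (species_comp F G) S /
     (\sum_(S' : species_comp F G 'I_n) weight (species_comp F G) S').
Proof.
by rewrite divr_ge0 ?weight_ge0 // sumr_ge0 // => S' _; exact: weight_ge0.
Qed.

Lemma remainder_prob_ge0 n E : 0 <= remainder_prob n E.
Proof.
apply: sumr_ge0 => S _; apply: mulr_ge0; first exact: comp_prob_ge0.
by apply: sumr_ge0 => Q _; rewrite invr_ge0.
Qed.

(** An inequality only: the law has mass 0 when the total weight vanishes, and a structure without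
    blocks contributes nothing. *)
Lemma remainder_prob_setC n E :
  remainder_prob n E + remainder_prob n (~` E) <= 1.
Proof.
rewrite -big_split /=.
set Z := \sum_(S' : species_comp F G 'I_n) weight (species_comp F G) S'.
apply: (@le_trans _ _ (\sum_(S : species_comp F G 'I_n)
   weight (species_comp F G) S / Z)).
  apply: ler_sum => S _; rewrite -mulrDr.
  rewrite -[leRHS]mulr1 ler_wpM2l ?comp_prob_ge0 //.
  rewrite [X in _ + X](eq_bigl (fun Q => (Q \in maximal_blocks S) &&
     ~~ `[< E (remainder Q) >])); last by move=> Q; rewrite asbool_neg.
  rewrite -bigID /= sumr_const -[leLHS]mulr_natr.
  have [->|m0] := eqVneq (#|maximal_blocks S|%:R : R) 0; first by rewrite mulr0.
  by rewrite mulVf.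
rewrite -mulr_suml -/Z; have [->|Z0] := eqVneq Z 0; first by rewrite mul0r.
by rewrite divff.
Qed.

(** For fixed [S] and [Q], injectivity of [x] leaves at most one index in [s] whose value is the
    remainder. *)
Lemma remainder_prob_sum n E (I : eqType) (s : seq I) (x : I -> XT) :
  injective x -> uniq s ->
  \sum_(i <- s | `[< E (x i) >]) remainder_prob n [set x i] <= remainder_prob n E.
Proof.
move=> xI us; rewrite exchange_big /=; apply: ler_sum => S _.
rewrite -mulr_sumr ler_wpM2l ?comp_prob_ge0 //.
under eq_bigr => i _ do rewrite big_mkcondr /=.
rewrite exchange_big /= [leRHS]big_mkcondr /=; apply: ler_sum => Q _.
set c := _^-1; have c0 : 0 <= c by rewrite invr_ge0 ler0n.
case: asboolP => EQ; last first.
  rewrite big1 // => i /asboolP Ei; case: asboolP => // /= e.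
  by case: EQ; rewrite e.
have [/hasP[i is_ /eqP xi]|/hasPn xn] := boolP (has (fun i => x i == remainder Q) s).
  rewrite big_mkcond (bigD1_seq i) //= big1 ?addr0; first last.
    move=> j ji; case: asboolP => // _; case: asboolP => //= e.
    by case/eqP: ji; apply: xI; rewrite xi.
  by case: asboolP => _ //; case: asboolP.
rewrite big_seq_cond big1 // => i /andP[is_ _]; case: asboolP => //= e.
by have /eqP := xn i is_; rewrite e.
Qed.

(** Let [r] be the size of [x]. Any set of [n - r] atoms with a [G]-structure on it can be glued to
    [x]. Since [r < n - r], this set is the only largest block, so its choice is deterministic and
    deleting it returns [x]. There are ['C(n, r)] such sets, each of total [G]-weight
    [egs G (n - r) * (n - r)!]. *)
Lemma remainder_prob_point n (x : XT) : (2 * tag x < n)%N ->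
  weight (species_comp (species_deriv F) G) (tagged x) / (tag x)`!%:R *
    egs G (n - tag x) / egs (species_comp F G) n <= remainder_prob n [set x].
Proof.
case: x => r y /= rn.
have rn' : (r < n - r)%N by rewrite ltn_subRL addnn -mul2n.
have rlen : (r <= n)%N by apply: ltnW; apply: leq_ltn_trans rn; rewrite leq_pmull.
pose mu := weight (species_comp (species_deriv F) G) y.
(* [K] holds the candidate largest blocks with their structure; [rel p S] says that [p] is the
   unique largest block of [S] and that its deletion leaves [x]. *)
pose K := {A : {set 'I_n} & G (elts A)}.
pose ok (p : K) := #|tag p| == (n - r)%N.
pose rel (p : K) (S : species_comp F G 'I_n) :=
  exists2 Q : elts (blocks S), Tagged (fun A => G (elts A)) (component Q) = p &
    [/\ maximal_blocks S = [set Q]%SET,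
      remainder Q = existT (fun n => species_comp (species_deriv F) G 'I_n) r y &
      weight (species_comp F G) S = mu * weight G (tagged p)].
have ex_rel (p : K) : ok p -> exists S, rel p S.
  case: p => A gam /eqP /= cA.
  have cAC : #|~: A|%SET = r.
    by apply/eqP; rewrite -(eqn_add2l (n - r)) -{1}cA cardsC card_ord subnK.
  have A0 : A != finset.set0.
    by rewrite -card_gt0 cA (leq_trans _ rn').
  (* The sizes [n - #|A|] and [r] are equal but not convertible, so [y] is first moved to the
     former. *)
  have [y' ey wy] : exists2 y' : species_comp (species_deriv F) G 'I_(n - #|A|),
      existT (fun n => species_comp (species_deriv F) G 'I_n) _ y' = existT _ r y &
      weight (species_comp (species_deriv F) G) y' = mu.
    by rewrite cA subKn //; exists y.
  have [S [AS [dS cS]]] := glue_block A0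
    (relabel (species_comp (species_deriv F) G) (bij_sym (bij_order A)) y') gam.
  exists S, (exist _ A AS); first by rewrite cS.
  split.
  - apply/setP => Q; rewrite !inE.
    have small (B : elts (blocks S)) : B != exist _ A AS -> (#|sval B| <= r)%N.
      move=> BA; rewrite -cAC subset_leq_card // -finset.disjoints_subset.
      case/and3P: (blocksP S) => _ /finset.trivIsetP tS _.
      by apply: tS => //; exact: svalP B.
    have [->|QA] := eqVneq Q (exist _ A AS).
      apply/forallP => B; have [->//|/small Br] := eqVneq B (exist _ A AS).
      by rewrite /= cA (leq_trans Br) // ltnW.
    apply/negbTE/negP => /forallP/(_ (exist _ A AS)) /=; rewrite cA.
    by rewrite leqNgt (leq_ltn_trans (small _ QA)).
  - by rewrite /remainder dS bij_symK ey.
  - by rewrite (weight_delete_block (exist _ A AS)) dS cS weight_relabel wy.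
have rel_uniq p p' S : rel p S -> rel p' S -> p = p'.
  move=> [Q <- [mQ _ _]] [Q' <- [mQ' _ _]].
  suff -> : Q = Q' by [].
  by apply/set1P; rewrite -mQ' mQ; exact/set1P.
set Z := \sum_(S' : species_comp F G 'I_n) weight (species_comp F G) S'.
have Z0 : 0 <= Z by apply: sumr_ge0 => S _; exact: weight_ge0.
(* By [rel_uniq] the inner sum has at most one term, so inserting it does not exceed the
   probability; exchanging the sums then makes [p] the outer variable, and [ex_rel] supplies an [S]
   for each. *)
apply: (@le_trans _ _ (\sum_(S : species_comp F G 'I_n)
   \sum_(p | ok p && `[< rel p S >]) mu * weight G (tagged p) / Z)); last first.
  apply: ler_sum => S _.
  have [[p /andP[okp relp]]|no] :=
      pselect (exists p, ok p && `[< rel p S >]); last first.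
    rewrite big_pred0 => [|p].
      apply: mulr_ge0; first exact: comp_prob_ge0.
      by apply: sumr_ge0 => Q _; rewrite invr_ge0 ler0n.
    by apply/negbTE/negP => okp; apply: no; exists p.
  rewrite (bigD1 p) /=; last by rewrite okp relp.
  rewrite big_pred0 ?addr0 => [|p']; last first.
    apply/negbTE/negP => /andP[/andP[_ /asboolP relp'] /eqP]; apply.
    by apply: rel_uniq relp' _; exact/asboolP.
  move/asboolP: relp => [Q _ [mQ eQ wS]].
  rewrite -[comp_weight S]/(weight (species_comp F G) S) mQ wS.
  rewrite -/Z big_mkcondr big_set1 cards1 invr1 eQ.
  by case: asboolP => [_|[]//]; rewrite mulr1.
rewrite (exchange_big_dep ok) /=; last by move=> S p _ /andP[].
apply: (@le_trans _ _ (\sum_(p | ok p) mu * weight G (tagged p) / Z)); last first.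
  apply: ler_sum => p okp; have [S relS] := ex_rel p okp.
  rewrite (bigD1 S) /=; last by rewrite okp; exact/asboolP.
  rewrite lerDl; apply: sumr_ge0 => S' _.
  by rewrite divr_ge0 // mulr_ge0 // weight_ge0.
rewrite -mulr_suml -mulr_sumr.
have -> : \sum_(p | ok p) weight G (tagged p) =
    'C(n, r)%:R * (egs G (n - r) * (n - r)`!%:R).
  transitivity (\sum_(A : {set 'I_n} | #|A| == (n - r)%N)
      \sum_(x : G (elts A)) weight G x).
    by rewrite sig_big_dep /=; apply: eq_bigl => p; rewrite andbT.
  rewrite (eq_bigr (fun=> egs G (n - r) * (n - r)`!%:R)); last first.
    by move=> A /eqP cA; rewrite sum_weight_egs card_elts cA.
  rewrite sumr_const -cardsE card_draws card_ord bin_sub //.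
  by rewrite mulr_natl.
have nf j : j`!%:R != 0 :> R by rewrite pnatr_eq0 -lt0n fact_gt0.
rewrite [egs (species_comp F G) n]/egs -/Z -(bin_fact rlen) !natrM.
(* When the total weight is 0, the convention that 0 has inverse 0 makes both sides vanish. *)
have [->|Zn] := eqVneq Z 0; first by rewrite mul0r invr0 !mulr0.
rewrite le_eqVlt; apply/orP; left; apply/eqP.
rewrite -[comp_weight y]/mu.
by field; rewrite Zn !nf pnatr_eq0 -lt0n bin_gt0.
Qed.
End RemainderLaw.

(** * Subexponential sequences *)

Section Subexponential.
Variables (R : realType) (H : nat -> R) (P S : R).
Hypothesis H0 : forall n, 0 <= H n.
Hypothesis P0 : 0 < P.
Hypothesis ratioH : H n / H n.+1 @[n --> \oo] --> P.
Hypothesis convH :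
  (H n)^-1 * (\sum_(i < n.+1) H i * H (n - i)%N) @[n --> \oo] --> 2 * S.
Hypothesis sumH : \sum_(i < n) H i * P ^+ i @[n --> \oo] --> S.

(** A zero coefficient would make the ratio 0, whatever its denominator, while the ratios approach
    [P > 0]. *)
Lemma near_coef_gt0 : \forall n \near \oo, 0 < H n.
Proof.
have : \forall n \near \oo, H n / H n.+1 > 0 by exact: (cvgr_gt P).
apply: filterS => n /lt0r_neq0; rewrite mulf_eq0 negb_or => /andP[Hn _].
by rewrite lt_neqAle eq_sym Hn H0.
Qed.

Lemma partial_sum_le n : \sum_(i < n) H i * P ^+ i <= S.
Proof.
rewrite -(cvg_lim (@Rhausdorff R) sumH).
apply: (@nondecreasing_cvgn_le _ (fun n => \sum_(i < n) H i * P ^+ i)).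
  apply/nondecreasing_seqP => k; rewrite big_ord_recr /= lerDl.
  by rewrite mulr_ge0 // exprn_ge0 // ltW.
by apply/cvg_ex; exists S.
Qed.

Lemma mass_ge0 : 0 <= S.
Proof. by have := partial_sum_le 0; rewrite big_ord0. Qed.

Lemma shift_ratio_cvg i : H (n - i)%N / H n @[n --> \oo] --> P ^+ i.
Proof.
elim: i => [|i IH].
  rewrite expr0; have : (1 : R) @[n --> \oo] --> (1 : R) by exact: cvg_cst.
  apply: cvg_trans; apply: near_eq_cvg.
  near=> n; rewrite subn0 divff // gt_eqF //.
  by near: n; exact: near_coef_gt0.
rewrite exprS.
have : H (n - i.+1)%N / H (n - i.+1).+1 * (H (n - i)%N / H n)
    @[n --> \oo] --> P * P ^+ i.
  by apply: cvgM IH; exact: (cvg_comp _ _ (cvg_subnr i.+1) ratioH).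
apply: cvg_trans; apply: near_eq_cvg; near=> n.
have iLn : (i < n)%N by near: n; exact: nbhs_infty_gt.
have Hn : H (n - i) != 0.
  by rewrite gt_eqF //; near: n; exact: (cvg_subnr i _ near_coef_gt0).
by rewrite /= subnSK // mulrA divfK.
Unshelve. all: by end_near. Qed.

Lemma head_cvg (c : nat -> R) K :
  (\sum_(i < K) c i * H (n - i)%N) / H n @[n --> \oo] -->
  \sum_(i < K) c i * P ^+ i.
Proof.
under eq_fun do rewrite mulr_suml.
apply: cvg_big => [|i _]; first exact: add_continuous.
under eq_fun do rewrite -mulrA.
by apply: cvgMl_tmp; exact: shift_ratio_cvg.
Qed.

Lemma tail_cvg K :
  (\sum_(K <= i < n.+1) H i * H (n - i)%N) / H n @[n --> \oo] -->
  2 * S - \sum_(i < K) H i * P ^+ i.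
Proof.
have : (H n)^-1 * (\sum_(i < n.+1) H i * H (n - i)%N) -
    (\sum_(i < K) H i * H (n - i)%N) / H n @[n --> \oo] -->
    2 * S - \sum_(i < K) H i * P ^+ i.
  by apply: cvgB convH _; exact: head_cvg.
apply: cvg_trans; apply: near_eq_cvg.
near=> n; have Kn : (K <= n.+1)%N by near: n; exact: (filterS (fun n => @leqW K n) (nbhs_infty_ge K)).
rewrite /= mulrC -mulrBl; congr (_ / _).
rewrite -(big_mkord xpredT (fun i => H i * H (n - i)%N)) (@big_cat_nat _ _ _ K) //=.
by rewrite big_mkord addrAC subrr add0r.
Unshelve. all: by end_near. Qed.

(** Of the limit [2 * S] of the normalised convolution, the first [K] terms account for a partial
    sum close to [S]; about [S] remains for all the others. *)
Lemma tail_le eps : 0 < eps -> exists K0, forall K, (K0 <= K)%N ->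
  \forall n \near \oo,
    \sum_(K <= i < n.+1) H i * H (n - i)%N <= (S + eps) * H n.
Proof.
move=> e0; have /(cvgr_gt S) /(_ (S - eps)) : \sum_(i < n) H i * P ^+ i @[n --> \oo] --> S by [].
rewrite ltrBlDr ltrDl => /(_ e0)[K0 _ sK0]; exists K0 => K K0K.
have : \forall n \near \oo,
    (\sum_(K <= i < n.+1) H i * H (n - i)%N) / H n < S + eps.
  apply: (cvgr_lt _ (@tail_cvg K)); have := sK0 K K0K; lra.
move=> h; near=> n; rewrite -ler_pdivrMr; last by near: n; exact: near_coef_gt0.
by apply/ltW; near: n.
Unshelve. all: by end_near. Qed.
Lemma sum_cpow_le_pow k K : \sum_(i < K) cpow H k i * P ^+ i <= S ^+ k.
Proof.
apply: le_trans (sum_cpow_le H0 K k (ltW P0)) _.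
apply: lerXn2r; rewrite ?nnegrE ?mass_ge0 ?partial_sum_le //.
by apply: sumr_ge0 => i _; rewrite mulr_ge0 // exprn_ge0 // ltW.
Qed.

(** One term of a non-negative series is at most its sum. This crude bound serves for the indices
    below the threshold of Kesten's bound. *)
Lemma cpow_le_pow k n : cpow H k n <= S ^+ k * P ^- n.
Proof.
rewrite ler_pdivlMr ?exprn_gt0 //; apply: le_trans (sum_cpow_le_pow k n.+1).
rewrite big_ord_recr /= lerDr sumr_ge0 // => i _.
by rewrite mulr_ge0 ?cpow_ge0 // exprn_ge0 // ltW.
Qed.

Lemma cpow_split k K n : (K <= n.+1)%N ->
  cpow H k.+1 n = \sum_(i < K) cpow H k i * H (n - i)%N +
    \sum_(K <= i < n.+1) cpow H k i * H (n - i)%N.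
Proof.
move=> Kn; rewrite cpowS -(big_mkord xpredT (fun i => cpow H k i * H (n - i)%N)).
by rewrite (@big_cat_nat _ _ _ K) //= big_mkord.
Qed.

(* Kesten's bound. The threshold N does not depend on k: the terms i < N of
   the convolution cost at most a multiple of S ^+ k, which the slack in
   (S + eps) ^+ k absorbs. *)
Lemma cpow_le_geom eps : 0 < eps ->
  exists2 C, 0 <= C & exists2 N, (forall n, (N <= n)%N -> 0 < H n) &
    forall k n, (N <= n)%N -> cpow H k n <= C * (S + eps) ^+ k * H n.
Proof.
move=> e0; have e20 : 0 < eps / 2 by rewrite divr_gt0.
have [K0 tl] := tail_le e20.
have [N1 _ tlN1] := filterI near_coef_gt0 (tl K0 (leqnn K0)).
(* The 1 makes [cpow H 0 n] vanish for [n >= N], which starts the induction. *)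
pose N := maxn 1 (maxn N1 K0).
have NN1 n : (N <= n)%N -> (N1 <= n)%N.
  by apply: leq_trans; rewrite !leq_max leqnn !orbT.
have [B B0 hB] : exists2 B, 0 < B &
    forall n, `|(\sum_(i < N) 1 * H (n - i)%N) / H n| <= B.
  have /cvg_seq_bounded/pinfty_ex_gt0[B B0 hB] :
      cvgn (fun n => (\sum_(i < N) 1 * H (n - i)%N) / H n : R^o).
    by apply/cvg_ex; eexists; exact: (@head_cvg (fun=> 1) N).
  by exists B => // n; exact: hB.
pose p := \sum_(i < N) P ^- i.
have Pi i : 0 <= P ^- i by rewrite invr_ge0 exprn_ge0 // ltW.
have p0 : 0 <= p by apply: sumr_ge0.
have S0 := mass_ge0.
(* Chosen so that [C * (eps / 2) = p * B]: the tail only uses up the factor [S + eps / 2], and the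
   remaining [eps / 2] covers the head. *)
pose C := 2 * (p * B) / eps.
have C0 : 0 <= C by rewrite /C divr_ge0 ?mulr_ge0 // ltW.
exists C => //; exists N => [n /NN1/tlN1[]//|].
elim=> [|k IH] n nN.
  rewrite /= (gtn_eqF (leq_trans _ nN)) ?leq_max ?ltnSn //.
  by rewrite expr0 mulr1 mulr_ge0.
have [Hn tn] := tlN1 _ (NN1 _ nN).
rewrite (@cpow_split _ N) ?(leqW nN) //.
have hd : \sum_(i < N) cpow H k i * H (n - i)%N <= S ^+ k * p * B * H n.
  apply: (@le_trans _ _ (\sum_(i < N) S ^+ k * p * H (n - i)%N)).
    apply: ler_sum => i _; rewrite ler_wpM2r // (le_trans (cpow_le_pow _ _)) //.
    rewrite ler_wpM2l ?exprn_ge0 // /p (bigD1 i) //= lerDl.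
    by apply: sumr_ge0.
  rewrite -mulr_sumr -!mulrA ler_wpM2l ?exprn_ge0 // ler_wpM2l //.
  rewrite -ler_pdivrMr //; apply: le_trans (hB n); apply: le_trans (ler_norm _).
  by under [X in _ <= X / _]eq_bigr do rewrite mul1r.
have tl' : \sum_(N <= i < n.+1) cpow H k i * H (n - i)%N <=
    C * (S + eps) ^+ k * ((S + eps / 2) * H n).
  apply: (@le_trans _ _ (C * (S + eps) ^+ k *
      \sum_(N <= i < n.+1) H i * H (n - i)%N)).
    rewrite mulr_sumr big_nat [leRHS]big_nat; apply: ler_sum => i /andP[Ni _].
    by rewrite mulrA ler_wpM2r // IH.
  apply: ler_wpM2l; first by rewrite mulr_ge0 // exprn_ge0 // addr_ge0 // ltW.
  have KN : (K0 <= N)%N by rewrite !leq_max leqnn !orbT.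
  apply: le_trans tn; rewrite [leRHS](@big_cat_nat _ _ _ N) ?(leqW nN) //= lerDr.
  by apply: sumr_ge0 => i _; rewrite mulr_ge0.
apply: le_trans (lerD hd tl') _.
have SkSe : S ^+ k <= (S + eps) ^+ k.
  by apply: lerXn2r; rewrite ?nnegrE ?addr_ge0 // ?lerDl ltW.
rewrite exprS [leRHS](_ : _ = C * (S + eps) ^+ k * ((S + eps / 2) * H n) +
   (S + eps) ^+ k * (p * B) * H n); last first.
  by rewrite /C; field; rewrite gt_eqF.
rewrite addrC lerD2l ler_wpM2r // -mulrA ler_wpM2r //.
by rewrite mulr_ge0 // ltW.
Qed.

(** Induction on [k]: relative to [H n], the head of the convolution gives at most [S ^+ k], and the
    tail gives the bound for [k] times about [S], hence [k * S ^+ k]. *)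
Lemma cpow_limsup k eps : 0 < eps ->
  \forall n \near \oo, cpow H k n <= (k%:R * S ^+ k.-1 + eps) * H n.
Proof.
elim: k eps => [|k IH] eps e0.
  near=> n; rewrite mul0r add0r /= gtn_eqF; last by near: n; exact: nbhs_infty_gt.
  by rewrite mulr_ge0 // ltW.
have S0 := mass_ge0.
pose A := k%:R * S ^+ k.-1.
have A0 : 0 <= A by rewrite mulr_ge0 ?exprn_ge0.
(* The accumulated error is [dl * (1 + A + S) + dl ^+ 2], which is at most [dl * (2 + A + S)] as
   soon as [dl <= 1]. *)
pose dl := eps / (2 + A + S + eps).
have den0 : 0 < 2 + A + S + eps by lra.
have dl0 : 0 < dl by rewrite divr_gt0.
have dl1 : dl <= 1 by rewrite ler_pdivrMr // mul1r; lra.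
have dle : dl * (2 + A + S) <= eps.
  by rewrite -mulrAC ler_pdivrMr // ler_wpM2l ?ltW //; lra.
have [N1 _ hN1] := IH dl dl0.
have [K0 tl] := tail_le dl0.
pose K := maxn N1 K0.
have hd : \forall n \near \oo,
    (\sum_(i < K) cpow H k i * H (n - i)%N) / H n < S ^+ k + dl.
  apply: (cvgr_lt _ (@head_cvg (cpow H k) K)).
  by apply: le_lt_trans (sum_cpow_le_pow k K) _; rewrite ltrDl.
near=> n.
have Hn : 0 < H n by near: n; exact: near_coef_gt0.
have Kn : (K <= n)%N by near: n; exact: nbhs_infty_ge.
rewrite (@cpow_split _ K) ?(leqW Kn) //.
have hdn : \sum_(i < K) cpow H k i * H (n - i)%N <= (S ^+ k + dl) * H n.
  by rewrite -ler_pdivrMr // ltW //; near: n.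
have tln : \sum_(K <= i < n.+1) cpow H k i * H (n - i)%N <=
    (A + dl) * ((S + dl) * H n).
  apply: (@le_trans _ _ ((A + dl) * \sum_(K <= i < n.+1) H i * H (n - i)%N)).
    rewrite mulr_sumr big_nat [leRHS]big_nat; apply: ler_sum => i /andP[Ki _].
    rewrite mulrA ler_wpM2r // hN1 //=.
    by apply: leq_trans Ki; rewrite leq_maxl.
  apply: ler_wpM2l; first by rewrite addr_ge0 // ltW.
  by near: n; apply: tl; rewrite leq_maxr.
apply: le_trans (lerD hdn tln) _; rewrite mulrA -mulrDl ler_wpM2r //=.
have -> : k.+1%:R * S ^+ k = S ^+ k + A * S.
  rewrite /A -natr1 mulrDl mul1r addrC; congr (_ + _).
  by case: (k) => [|j]; rewrite ?mul0r // -mulrA -exprSr.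
have : dl * dl <= dl by rewrite ler_piMr // ltW.
lra.
Unshelve. all: by end_near. Qed.
End Subexponential.

(** * Bounds uniform in the shift, and dominated sums *)

Section ShiftedPowers.
Variables (R : realType) (H : nat -> R) (P S : R).
Hypothesis H0 : forall n, 0 <= H n.
Hypothesis P0 : 0 < P.
Hypothesis ratioH : H n / H n.+1 @[n --> \oo] --> P.
Hypothesis convH :
  (H n)^-1 * (\sum_(i < n.+1) H i * H (n - i)%N) @[n --> \oo] --> 2 * S.
Hypothesis sumH : \sum_(i < n) H i * P ^+ i @[n --> \oo] --> S.

Lemma mass_gt0 : 0 < S.
Proof.
have [N _ /(_ N (leqnn N)) HN] := near_coef_gt0 H0 P0 ratioH.
apply: lt_le_trans (partial_sum_le H0 P0 sumH N.+1).
rewrite big_ord_recr /= ltr_wpDl ?mulr_gt0 ?exprn_gt0 //.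
by apply: sumr_ge0 => i _; rewrite mulr_ge0 // exprn_ge0 // ltW.
Qed.

(** The shift [t] may be as large as [n]. If [n - t] is above the threshold, Kesten's bound applies
    and the ratio condition yields [H (n - t) <= (theta * P) ^+ t * H n]; otherwise the crude bound
    is compared with [H N]. *)
Lemma cpow_shift_le theta : 1 < theta ->
  exists2 C, 0 <= C & exists N, forall k t n, (N <= n)%N -> (t <= n)%N ->
    cpow H k (n - t) <= C * ((theta * S) ^+ k * (theta * P) ^+ t) * H n.
Proof.
move=> th1; have S0 := mass_gt0.
have th0 : 0 < theta by apply: lt_trans th1.
have e0 : 0 < (theta - 1) * S by rewrite mulr_gt0 // subr_gt0.
have [C C0 [N0 HN0 hC]] := cpow_le_geom H0 P0 ratioH convH sumH e0.
have Seps : S + (theta - 1) * S = theta * S by ring.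
rewrite Seps in hC.
have tP0 : 0 < theta * P by rewrite mulr_gt0.
have : \forall n \near \oo, H n / H n.+1 < theta * P.
  by apply: (cvgr_lt _ ratioH); rewrite ltr_pMl.
case=> N1 _ hN1; pose N := maxn N0 N1.
have N0N n : (N <= n)%N -> (N0 <= n)%N by apply: leq_trans; rewrite leq_maxl.
have N1N n : (N <= n)%N -> (N1 <= n)%N by apply: leq_trans; rewrite leq_maxr.
have geo i n : (N <= n)%N -> H n <= (theta * P) ^+ i * H (n + i).
  move=> Nn; elim: i => [|i IH]; first by rewrite addn0 mul1r.
  apply: le_trans IH _; rewrite exprSr -mulrA.
  apply: ler_wpM2l; first exact/exprn_ge0/ltW.
  have Nni : (N <= n + i)%N by rewrite (leq_trans Nn) ?leq_addr.
  rewrite addnS -ler_pdivrMr ?HN0 ?N0N ?leqW //.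
  by apply/ltW/hN1; exact: N1N.
have HNp : 0 < H N by rewrite HN0 // leq_maxl.
(* [p] and [q] only serve to dominate each of their terms: [P ^- (n - t)] with [n - t < N], and
   [(theta * P) ^- i] with [i <= N]. *)
pose p := \sum_(i < N) P ^- i; pose q := \sum_(i < N.+1) (theta * P) ^- i.
have Pi i : 0 <= P ^- i by rewrite invr_ge0 exprn_ge0 // ltW.
have tPi i : 0 <= (theta * P) ^- i by rewrite invr_ge0 exprn_ge0 // ltW.
have p0 : 0 <= p by apply: sumr_ge0.
have q0 : 0 <= q by apply: sumr_ge0.
have c0 : 0 <= p * q / H N by rewrite divr_ge0 ?mulr_ge0 // ltW.
exists (C + p * q / H N); first by rewrite addr_ge0.
exists N => k t n Nn tn.
have pk0 : 0 <= (theta * S) ^+ k * (theta * P) ^+ t * H n.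
  by rewrite !mulr_ge0 // exprn_ge0 // ?ltW // mulr_gt0.
have pC0 := mulr_ge0 C0 pk0; have pc0 := mulr_ge0 c0 pk0.
rewrite -mulrA mulrDl; have [Nnt|ntN] := leqP N (n - t).
  rewrite ler_wpDr //; apply: le_trans (hC k _ (N0N _ Nnt)) _.
  rewrite -!mulrA ler_wpM2l //.
  apply: ler_wpM2l; first by rewrite exprn_ge0 // mulr_ge0 // ltW.
  by have := geo t _ Nnt; rewrite subnK.
(* Now [n - t < N]. The ratio condition is used from [N] up to [n] instead; [n - N] falls short of
   [t] by at most [N], a difference absorbed by [q]. *)
rewrite ler_wpDl //.
apply: le_trans (cpow_le_pow H0 P0 sumH _ _) _.
have h1 : S ^+ k * P ^- (n - t) <= (theta * S) ^+ k * p.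
  apply: ler_pM => //; first by rewrite exprn_ge0 // ltW.
    by rewrite lerXn2r ?nnegrE ?mulr_ge0 // ?ltW // ltr_pMl.
  by rewrite /p (bigD1 (Ordinal ntN)) //= lerDl sumr_ge0.
have h2 : H N <= (theta * P) ^+ t * q * H n.
  have := geo (n - N)%N N (leqnn N); rewrite subnKC //.
  move/le_trans; apply; rewrite ler_wpM2r //.
  have st : (t - (n - N) < N.+1)%N.
    by rewrite ltnS leq_subLR subnK.
  have nNt : (n - N <= t)%N by rewrite leq_subLR addnC -leq_subLR ltnW.
  apply: (@le_trans _ _ ((theta * P) ^+ t * (theta * P) ^- (t - (n - N)))).
    have -> : (theta * P) ^+ t =
        (theta * P) ^+ (t - (n - N)) * (theta * P) ^+ (n - N).
      by rewrite -exprD subnK.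
    by rewrite mulrAC divff ?mul1r // expf_neq0 // gt_eqF.
  apply: ler_wpM2l; first exact/exprn_ge0/ltW.
  by rewrite /q (bigD1 (Ordinal st)) //= lerDl sumr_ge0.
apply: le_trans h1 _.
have := ler_wpM2l (mulr_ge0 (exprn_ge0 k (ltW (mulr_gt0 th0 S0))) p0) h2.
rewrite -ler_pdivlMr // => /le_trans; apply.
rewrite le_eqVlt; apply/orP; left; apply/eqP; field.
by rewrite gt_eqF.
Qed.

Lemma cpow_shift_limsup k t eps : 0 < eps ->
  \forall n \near \oo,
    cpow H k (n - t) <= (k%:R * S ^+ k.-1 * P ^+ t + eps) * H n.
Proof.
move=> e0; have S0 := ltW mass_gt0.
pose A := k%:R * S ^+ k.-1; pose p := P ^+ t.
have A0 : 0 <= A by rewrite mulr_ge0 ?exprn_ge0.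
have p0 : 0 <= p by rewrite exprn_ge0 // ltW.
pose dl := eps / (1 + A + p + eps).
have den0 : 0 < 1 + A + p + eps by lra.
have dl0 : 0 < dl by rewrite divr_gt0.
have dl1 : dl <= 1 by rewrite ler_pdivrMr // mul1r; lra.
have dle : dl * (1 + A + p) <= eps.
  by rewrite -mulrAC ler_pdivrMr // ler_wpM2l ?ltW //; lra.
have hk := cpow_limsup H0 P0 ratioH convH sumH k dl0.
have hs : \forall n \near \oo, H (n - t)%N / H n < p + dl.
  by apply: (cvgr_lt (P ^+ t)); [exact: shift_ratio_cvg | rewrite ltrDl].
near=> n.
have Hn : 0 < H n by near: n; exact: near_coef_gt0 ratioH.
apply: (@le_trans _ _ ((A + dl) * H (n - t)%N)).
  by near: n; exact: (cvg_subnr t _ hk).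
have : H (n - t)%N <= (p + dl) * H n by rewrite -ler_pdivrMr // ltW //; near: n.
move/(ler_wpM2l (addr_ge0 A0 (ltW dl0)))/le_trans; apply.
rewrite mulrA ler_wpM2r //.
have : dl * dl <= dl by rewrite ler_piMr // ltW.
rewrite -/A -/p; lra.
Unshelve. all: by end_near. Qed.

(** Dominated convergence in limsup form. The bound holds for all [M] at once because the sum it
    will be applied to has a number of terms depending on [n]. *)
Lemma dominated_limsup (T : nat -> nat -> R) (e B : nat -> R) (L : R) (N : nat) :
  (forall k n, 0 <= T k n) ->
  (forall k eps, 0 < eps -> \forall n \near \oo, T k n <= (e k + eps) * H n) ->
  (forall k, 0 <= B k) ->
  (forall k n, (N <= n)%N -> T k n <= B k * H n) ->
  cvgn (series B) -> (forall K, \sum_(k < K) e k <= L) ->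
  forall eps, 0 < eps -> \forall n \near \oo,
    forall M, \sum_(k < M) T k n <= (L + eps) * H n.
Proof.
move=> T0 Te B0 TB cB eL eps eps0; have e20 : 0 < eps / 2 by rewrite divr_gt0.
have Bnd M : \sum_(k < M) B k <= limn (series B).
  rewrite -(big_mkord xpredT); apply: nondecreasing_cvgn_le => //.
  apply/nondecreasing_seqP => k; rewrite /series /= big_nat_recr //= lerDl //.
have [K hK] : exists K, limn (series B) - eps / 2 < \sum_(k < K) B k.
  have : limn (series B) - eps / 2 < limn (series B) by rewrite ltrBlDr ltrDl.
  move/(cvgr_gt _ cB) => [K _ /(_ K (leqnn K))] /=.
  by rewrite /series /= big_mkord; exists K.
(* The successor guards against [K = 0]. *)
pose de := eps / 2 / K.+1%:R.
have de0 : 0 < de by rewrite divr_gt0.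
have hd : \forall n \near \oo, forall k : 'I_K, T k n <= (e k + de) * H n.
  by apply: filter_forall => k; exact: Te.
near=> n => M.
have Nn : (N <= n)%N by near: n; exact: nbhs_infty_ge.
apply: (@le_trans _ _ (\sum_(k < K + M) T k n)).
  rewrite addnC big_split_ord /= lerDl; exact: sumr_ge0.
rewrite big_split_ord /=.
apply: (@le_trans _ _ ((L + eps / 2) * H n + eps / 2 * H n)); last by rewrite -mulrDl; lra.
apply: lerD.
  apply: (@le_trans _ _ (\sum_(k < K) (e k + de) * H n)).
    apply: ler_sum => k _; move: k; near: n; exact: hd.
  rewrite -mulr_suml ler_wpM2r // big_split /=; apply: lerD; first exact: eL.
  rewrite sumr_const card_ord.
  rewrite -[de *+ K]mulr_natr /de -mulrA.
  apply: ler_piMr; first exact: ltW.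
  rewrite mulrC ler_pdivrMr //.
  by rewrite mul1r ler_nat.
apply: (@le_trans _ _ (\sum_(k < M) B (K + k)%N * H n)).
  by apply: ler_sum => k _; exact: TB.
rewrite -mulr_suml ler_wpM2r //.
have := Bnd (K + M)%N; rewrite big_split_ord /=; lra.
Unshelve. all: by end_near. Qed.
End ShiftedPowers.

(** * Coefficients of the composition *)

Section PowerSeriesFacts.
Variable R : realType.
Implicit Types (g h : nat -> R) (r l : R).

Lemma ps_eval_cvg g r : (forall n, 0 <= g n) -> 0 <= r ->
  (ps_eval g r < +oo)%E ->
  \sum_(i < n) g i * r ^+ i @[n --> \oo] --> fine (ps_eval g r).
Proof.
move=> g0 r0 fin.
have u0 n : (0 <= (g n * r ^+ n)%:E)%E by rewrite lee_fin mulr_ge0 // exprn_ge0.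
have : (\sum_(0 <= i < n) (g i * r ^+ i)%:E)%E @[n --> \oo] --> ps_eval g r.
  by apply: is_cvg_nneseries => n _ _; exact: u0.
have -> : ps_eval g r = (fine (ps_eval g r))%:E.
  by rewrite fineK // ge0_fin_numE // nneseries_ge0.
move/fine_cvg => /=; apply: cvg_trans; apply: near_eq_cvg.
by apply: nearW => n; rewrite /= sumEFin /= big_mkord.
Qed.

Lemma ps_evalE g r l : \sum_(i < n) g i * r ^+ i @[n --> \oo] --> l ->
  ps_eval g r = l%:E.
Proof.
move=> gl; apply: cvg_lim => //.
have : (\sum_(i < n) g i * r ^+ i)%:E @[n --> \oo] --> l%:E.
  by apply/cvg_EFin; [exact: nearW | exact: gl].
apply: cvg_trans; apply: near_eq_cvg; apply: nearW => n.
by rewrite /= sumEFin big_mkord.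
Qed.

Lemma divXn_sum m g h r n : is_divXn m g h ->
  \sum_(i < m + n) g i * r ^+ i = r ^+ m * \sum_(i < n) h i * r ^+ i.
Proof.
move=> [g0 hg]; rewrite big_split_ord /= big1 ?add0r => [|i _]; last first.
  by rewrite g0 ?mul0r.
by rewrite mulr_sumr; apply: eq_bigr => i _; rewrite hg exprD addnC; ring.
Qed.

Lemma cvradius_divXn m g h : is_divXn m g h -> cvradius h = cvradius g.
Proof.
move=> gh; congr ereal_sup; rewrite (_ : [set r : R | _] =
  [set r : R | 0 <= r /\ cvgn (pseries g r)]) //.
apply/seteqP; split=> r /= [r0 cv]; split=> //.
  have /cvg_ex[l hl] := cv; apply/cvg_ex; exists (r ^+ m * l).
  rewrite -(cvg_shiftn m); have : r ^+ m * pseries h r n @[n --> \oo] --> r ^+ m * l.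
    exact: cvgMl_tmp hl.
  apply: cvg_trans; apply: near_eq_cvg; apply: nearW => n.
  by rewrite /pseries /series /= !big_mkord addnC (divXn_sum _ _ gh).
(* Dividing by [r ^+ m] is impossible at 0, where the partial sums are eventually constant. *)
have [r00|rn0] := eqVneq r 0.
  apply/cvg_ex; exists (h 0%N); rewrite r00.
  have : h 0%N @[n --> \oo] --> h 0%N by exact: cvg_cst.
  apply: cvg_trans; apply: near_eq_cvg; near=> n.
  have n0 : (0 < n)%N by near: n; exact: nbhs_infty_gt.
  rewrite /pseries /series /= big_mkord -(prednK n0) big_ord_recl /= expr0 mulr1.
  by rewrite big1 ?addr0 // => i _; rewrite /= /bump /= exprS mul0r mulr0.
have /cvg_ex[l hl] := cv; apply/cvg_ex; exists (r ^- m * l).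
have : r ^- m * pseries g r (n + m)%N @[n --> \oo] --> r ^- m * l.
  by apply: cvgMl_tmp; move: hl; rewrite -(cvg_shiftn m).
apply: cvg_trans; apply: near_eq_cvg; apply: nearW => n.
rewrite /pseries /series /= !big_mkord addnC (divXn_sum _ _ gh).
by rewrite mulKf // expf_neq0.
Unshelve. all: by end_near. Qed.

Lemma cpow1 g n : cpow g 1 n = g n.
Proof.
rewrite cpowS big_ord_recl /= mul1r subn0 big1 ?addr0 // => i _.
by rewrite mul0r.
Qed.

Lemma dilate_sum h d r n : (0 < d)%N -> (forall i, ~~ (d %| i)%N -> h i = 0) ->
  \sum_(i < d * n) h i * r ^+ i = \sum_(i < n) h (d * i)%N * (r ^+ d) ^+ i.
Proof.
move=> d0 hd; rewrite -(horner_poly (d * n) h r) poly_dilate // horner_comp.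
by rewrite hornerXn horner_poly.
Qed.

Lemma cvg_within_multiples d : (0 < d)%N ->
  (d * n)%N @[n --> \oo] --> within (multiples d) \oo.
Proof.
move=> d0 A [M _ hM]; exists M => // n Mn; apply: hM => /=.
  by rewrite (leq_trans Mn) // leq_pmull.
exact: dvdn_mulr.
Qed.

(** Passing to [H n = h (d * n)] turns limits along the multiples of [d] into ordinary limits, with
    [rho ^+ d] in place of [rho] and the same mass [S]. *)
Lemma classS_dilate d h rho : (0 < d)%N -> classS d h -> cvradius h = rho%:E ->
  let H n := h (d * n)%N in let S := fine (ps_eval h rho) in
  [/\ 0 < rho, forall n, 0 <= h n & forall n, ~~ (d %| n)%N -> h n = 0] /\
  [/\ H n / H n.+1 @[n --> \oo] --> rho ^+ d,
      (H n)^-1 * (\sum_(i < n.+1) H i * H (n - i)%N) @[n --> \oo] --> 2 * S,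
      \sum_(i < n) H i * (rho ^+ d) ^+ i @[n --> \oo] --> S &
      \sum_(i < n) h i * rho ^+ i @[n --> \oo] --> S].
Proof.
move=> d0 [rho' [[rho0 -> h0 hd] [ratio fin conv]]] [rhoE].
subst rho' => H S; have sumh := ps_eval_cvg h0 (ltW rho0) fin.
split=> //; split=> //.
- have : h (d * n)%N / h (d * n + d)%N @[n --> \oo] --> rho ^+ d.
    exact: (cvg_comp _ _ (cvg_within_multiples d0) ratio).
  apply: cvg_trans; apply: near_eq_cvg; apply: nearW => n /=.
  by rewrite /H mulnS addnC.
- have : (h (d * n)%N)^-1 *
      (\sum_(i < (d * n).+1) h i * h (d * n - i)%N) @[n --> \oo] --> 2 * S.
    exact: (cvg_comp _ _ (cvg_within_multiples d0) conv).
  apply: cvg_trans; apply: near_eq_cvg; apply: nearW => n /=.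
  have c2 (g : nat -> R) k : \sum_(i < k.+1) g i * g (k - i)%N = cpow g 2 k.
    by rewrite cpowS; apply: eq_bigr => i _; rewrite cpow1.
  by rewrite !c2 (cpow_dilate _ _ d0 hd) dvdn_mulr // mulKn.
- have : \sum_(i < d * n) h i * rho ^+ i @[n --> \oo] --> S.
    apply: (cvg_comp (fun n => d * n)%N _ _ sumh) => A [M _ hM]; exists M => // n Mn.
    apply: hM => /=; by rewrite (leq_trans Mn) // leq_pmull.
  apply: cvg_trans; apply: near_eq_cvg; apply: nearW => n /=.
  by rewrite dilate_sum.
Qed.
End PowerSeriesFacts.

(** * Evaluating a composition of power series *)

Section Substitution.
Variable R : realType.
Implicit Types f g : nat -> R.

Lemma cpow_small g k n : g 0%N = 0 -> (n < k)%N -> cpow g k n = 0.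
Proof.
move=> g0 nk; rewrite (@cpow_shift _ g (fun i => g (i + 1)%N) 1) //.
  by rewrite muln1 nk.
by case.
Qed.

(** Everything is non-negative, so two inequalities suffice: truncating the composition gives at
    most [Lam], and each finite part of the outer sum, with [g] truncated as well, is reached by
    some partial sum. *)
Lemma subst_sum_cvg f g (x sigma Lam : R) :
  (forall n, 0 <= f n) -> (forall n, 0 <= g n) -> g 0%N = 0 -> 0 <= x ->
  \sum_(i < n) g i * x ^+ i @[n --> \oo] --> sigma ->
  \sum_(k < n) f k * sigma ^+ k @[n --> \oo] --> Lam ->
  \sum_(n < N) (\sum_(k < n.+1) f k * cpow g k n) * x ^+ n @[N --> \oo] --> Lam.
Proof.
move=> f0 g0 g00 x0 gs fL.
have xi i : 0 <= x ^+ i by rewrite exprn_ge0.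
have gx i : 0 <= g i * x ^+ i by rewrite mulr_ge0.
pose u N := \sum_(n < N) (\sum_(k < n.+1) f k * cpow g k n) * x ^+ n.
have sn : nondecreasing_seq (fun n => \sum_(i < n) g i * x ^+ i).
  by apply/nondecreasing_seqP => n; rewrite big_ord_recr /= lerDl.
have g_le n : \sum_(i < n) g i * x ^+ i <= sigma.
  rewrite -(cvg_lim (@Rhausdorff R) gs).
  by apply: (nondecreasing_cvgn_le sn); apply/cvg_ex; exists sigma.
have s0 : 0 <= sigma by have := g_le 0%N; rewrite big_ord0.
have f_le n : \sum_(k < n) f k * sigma ^+ k <= Lam.
  rewrite -(cvg_lim (@Rhausdorff R) fL).
  apply: (@nondecreasing_cvgn_le _ (fun n => \sum_(k < n) f k * sigma ^+ k)).
    apply/nondecreasing_seqP => k.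
    by rewrite big_ord_recr /= lerDl mulr_ge0 // exprn_ge0.
  by apply/cvg_ex; exists Lam.
(* As [g] has no constant term, [cpow g k n] vanishes for [n < k], so the range of [k] can be
   enlarged freely. *)
have uE N K : (N <= K)%N ->
    u N = \sum_(k < K) f k * \sum_(n < N) cpow g k n * x ^+ n.
  move=> NK; under [RHS]eq_bigr do rewrite mulr_sumr.
  rewrite exchange_big /=; apply: eq_bigr => n _; rewrite mulr_suml.
  have nK : (n.+1 <= K)%N by apply: leq_trans NK.
  rewrite -(subnKC nK) [RHS]big_split_ord -[RHS]/(_ + _) [X in _ + X]big1 ?addr0.
    by apply: eq_bigr => k _; rewrite mulrA.
  by move=> k _; rewrite cpow_small ?mul0r ?mulr0 // ltnS leq_addr.
have c0 k n : 0 <= cpow g k n * x ^+ n by rewrite mulr_ge0 ?cpow_ge0.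
have un : nondecreasing_seq u.
  apply/nondecreasing_seqP => n; rewrite [u n.+1]big_ord_recr /= lerDl.
  rewrite mulr_suml; apply: sumr_ge0 => k _.
  by rewrite -mulrA mulr_ge0.
have uL N : u N <= Lam.
  rewrite (uE N N) //; apply: le_trans (f_le N); apply: ler_sum => k _.
  rewrite ler_wpM2l //; apply: le_trans (sum_cpow_le g0 N k x0) _.
  by rewrite lerXn2r ?nnegrE ?sumr_ge0.
have ucv : cvgn u.
  apply: nondecreasing_is_cvgn => //; exists Lam => _ [n _ <-]; exact: uL.
suff -> : Lam = limn u by [].
apply/eqP; rewrite eq_le; apply/andP; split; last first.
  by apply: limr_le => //; exact: nearW.
rewrite -(cvg_lim (@Rhausdorff R) fL); apply: limr_le.
  by apply/cvg_ex; exists Lam.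
apply: nearW => K.
have hK : \sum_(k < K) f k * (\sum_(i < N) g i * x ^+ i) ^+ k @[N --> \oo] -->
    \sum_(k < K) f k * sigma ^+ k.
  apply: cvg_big => [|k _]; first exact: add_continuous.
  apply: cvgMl_tmp; elim: (k : nat) => [|j IH]; first exact: cvg_cst.
  by under eq_fun do rewrite exprS; rewrite exprS; exact: cvgM.
rewrite -(cvg_lim (@Rhausdorff R) hK); apply: limr_le.
  by apply/cvg_ex; eexists; exact: hK.
(* Degree [K * N] covers all powers of exponent below [K] of the truncation of [g] at [N]. *)
apply: nearW => N; apply: le_trans (nondecreasing_cvgn_le un ucv (K * N).+1).
rewrite (uE _ (K + (K * N).+1)%N) ?leq_addl // big_split_ord /=.
rewrite -[leLHS]addr0 lerD //; last first.
  by apply: sumr_ge0 => k _; rewrite mulr_ge0 // sumr_ge0.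
apply: ler_sum => k _; rewrite ler_wpM2l //.
apply: le_trans (le_sum_cpow g0 N k x0) _.
have kK : ((k * N).+1 <= (K * N).+1)%N by rewrite ltnS leq_mul2r ltnW ?orbT.
by rewrite -(subnKC kK) [leRHS]big_split_ord /= lerDl sumr_ge0.
Qed.

(** A mean value bound: [k x^(k-1) (r - x) <= r^k - x^k]. It dominates the derived series at [x] by
    the original one at [r > x]. *)
Lemma mulrn_expr_le (x r : R) k : 0 <= x -> x <= r ->
  k%:R * x ^+ k.-1 * (r - x) <= r ^+ k.
Proof.
move=> x0 xr; elim: k => [|k IH]; first by rewrite !mul0r expr0.
have r0 := le_trans x0 xr.
have xk : x ^+ k <= r ^+ k by rewrite lerXn2r.
apply: (@le_trans _ _ (x * r ^+ k + r ^+ k * (r - x))); last by rewrite exprS; lra.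
apply: (@le_trans _ _ (x * (k%:R * x ^+ k.-1 * (r - x)) + x ^+ k * (r - x))).
  rewrite /= -natr1 !mulrDl mul1r lerD2r le_eqVlt; apply/orP; left; apply/eqP.
  by case: (k) => [|j]; rewrite ?mul0r ?mulr0 //= exprS; ring.
by rewrite lerD ?ler_wpM2l ?ler_wpM2r // subr_ge0.
Qed.
End Substitution.

(** * Periodicity and the upper bound for the composition *)

Section CompositionCoefficients.
Variables (R : realType) (f g h : nat -> R) (d m a : nat) (rho r : R).
Let D := (d %/ gcdn m d)%N.
Let H n := h (d * n)%N.
Let P := rho ^+ d.
Variable S : R.
Hypothesis f0 : forall k, 0 <= f k.
Hypothesis d0 : (0 < d)%N.
Hypothesis md : (m < d)%N.
Hypothesis aD : (a < D)%N.
Hypothesis gh : is_divXn m g h.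
Hypothesis rho0 : 0 < rho.
Hypothesis h0 : forall n, 0 <= h n.
Hypothesis hd : forall n, ~~ (d %| n)%N -> h n = 0.
Hypothesis ratioH : H n / H n.+1 @[n --> \oo] --> P.
Hypothesis convH :
  (H n)^-1 * (\sum_(i < n.+1) H i * H (n - i)%N) @[n --> \oo] --> 2 * S.
Hypothesis sumH : \sum_(i < n) H i * P ^+ i @[n --> \oo] --> S.
Let sigma := rho ^+ m * S.
Hypothesis sigma_r : sigma < r.
Hypothesis fr : cvgn (series (fun k => f k * r ^+ k)).

Let H0 n : 0 <= H n. Proof. exact: h0. Qed.
Let P0 : 0 < P. Proof. by rewrite exprn_gt0. Qed.
Let S0 : 0 < S. Proof. exact: mass_gt0 H0 P0 ratioH sumH. Qed.
Let sigma0 : 0 < sigma. Proof. by rewrite mulr_gt0 ?exprn_gt0. Qed.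

Definition coef_mod k := if k == a %[mod D] then f k else 0.

Lemma gcdmd_gt0 : (0 < gcdn m d)%N. Proof. by rewrite gcdn_gt0 d0 orbT. Qed.

(** [D] is the order of [m] modulo [d]: after division by the gcd, [m] becomes prime to [D]. *)
Lemma dvdn_mul_period x : (d %| x * m)%N = (D %| x)%N.
Proof.
have dE : (D * gcdn m d = d)%N by rewrite divnK // dvdn_gcdr.
have mE : (m %/ gcdn m d * gcdn m d = m)%N by rewrite divnK // dvdn_gcdl.
rewrite -[X in (X %| _)%N]dE -[X in (_ %| x * X)%N]mE mulnA.
rewrite dvdn_pmul2r ?gcdmd_gt0 // Gauss_dvdl //.
rewrite /coprime -(eqn_pmul2r gcdmd_gt0) muln_gcdl dE mE mul1n.
by rewrite gcdnC.
Qed.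

Lemma eqmod_le k : k == a %[mod D] -> (a <= k)%N.
Proof. by move=> /eqP e; rewrite -(modn_small aD) -e leq_mod. Qed.

(** How many steps of length [d] separate the lowest degree [k m] of [G^k] from [a m]. For [k]
    congruent to [a] modulo [D], subtraction and division are both exact. *)
Definition period_shift k := ((k - a) * m %/ d)%N.

Lemma period_shiftE k : k == a %[mod D] ->
  (k * m = a * m + d * period_shift k)%N.
Proof.
move=> ka; have ak := eqmod_le ka.
rewrite [(d * _)%N]mulnC divnK ?dvdn_mul_period -?eqn_mod_dvd //.
by rewrite -mulnDl subnKC.
Qed.

Lemma period_shift_le k : (period_shift k <= k)%N.
Proof.
rewrite (@leq_trans (k - a)) ?leq_subr // /period_shift.
by rewrite -[leqRHS](mulnK _ d0) leq_div2r // leq_mul2l (ltnW md) orbT.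
Qed.

Lemma cpow_period k n : cpow g k (a * m + d * n) =
  if (k == a %[mod D]) && (period_shift k <= n)%N
  then cpow H k (n - period_shift k) else 0.
Proof.
have [g0 hg] := gh; rewrite (cpow_shift k _ g0 hg).
case: ifP => [lt|/negbT]; last rewrite -leqNgt => le.
  case: ifP => // /andP[/period_shiftE kE tn]; move: lt.
  by rewrite kE ltn_add2l ltn_pmul2l // ltnNge tn.
rewrite (cpow_dilate k _ d0 hd); case ka: (k == a %[mod D]) => /=; last first.
  case: ifP => // dvd; move: ka; have := dvd; rewrite -eqn_mod_dvd //.
  rewrite addnC mulnC modnMDl; case: (leqP a k) => ak.
    by rewrite eq_sym eqn_mod_dvd ?leq_mul2r ?ak ?orbT // -mulnBl dvdn_mul_period
       eqn_mod_dvd // => ->.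
  rewrite eqn_mod_dvd ?leq_mul2r ?(ltnW ak) ?orbT // -mulnBl dvdn_mul_period.
  by rewrite eq_sym eqn_mod_dvd ?(ltnW ak) // => ->.
have kE := period_shiftE ka; move: le; rewrite kE leq_add2l leq_pmul2l // => tn.
by rewrite tn subnDl -mulnBr dvdn_mulr // mulKn.
Qed.

Lemma derivative_series_cvg :
  cvgn (series (fun k => k%:R * coef_mod k * sigma ^+ k.-1)).
Proof.
have rs : 0 < r - sigma by rewrite subr_gt0.
have r0 : 0 < r by apply: lt_trans sigma_r.
have c0 k : 0 <= coef_mod k by rewrite /coef_mod; case: ifP.
have cf k : coef_mod k <= f k by rewrite /coef_mod; case: ifP.
apply: (@series_le_cvg _ _ (fun k => (r - sigma)^-1 * (f k * r ^+ k))).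
- by move=> k; rewrite !mulr_ge0 ?exprn_ge0 // ltW.
- by move=> k; rewrite !mulr_ge0 ?invr_ge0 ?exprn_ge0 // ltW.
- move=> k; rewrite ler_pdivlMl //.
  apply: le_trans (ler_wpM2l (f0 k) (mulrn_expr_le k (ltW sigma0) (ltW sigma_r))).
  rewrite [leLHS](_ : _ = coef_mod k * (k%:R * sigma ^+ k.-1 * (r - sigma))).
    rewrite ler_wpM2r // !mulr_ge0 ?exprn_ge0 // ltW //.
  by ring.
- exact: is_cvg_seriesZ.
Qed.

Let Lam := limn (series (fun k => k%:R * coef_mod k * sigma ^+ k.-1)).

(** The [k]-th term is asymptotically at most [k f_k S^(k-1) P^t] times [H n], with
    [t = period_shift k]. Since [rho^(k m) = rho^(a m) P^t], this is [rho^(m - a m)] times the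
    [k]-th term of the series [Lam] of the derivative at [sigma]. *)
Lemma composition_coef_limsup eps : 0 < eps -> \forall n \near \oo,
  \sum_(k < (a * m + d * n).+1) f k * cpow g k (a * m + d * n) <=
    (rho ^+ m / rho ^+ (a * m) * Lam + eps) * H n.
Proof.
move=> e0.
have nz i : rho ^+ i != 0 by rewrite expf_neq0 // gt_eqF.
pose T k n := f k * (if (k == a %[mod D]) && (period_shift k <= n)%N
  then cpow H k (n - period_shift k) else 0).
(* As period_shift k <= k, the two factors theta of Kesten's bound cost at
   most theta ^+ (2 * k), turning sigma ^+ k into r ^+ k. *)
pose theta := Num.sqrt (r / sigma).
have rs1 : 1 < r / sigma by rewrite ltr_pdivlMr // mul1r.
have th1 : 1 < theta by rewrite -sqrtr1 ltr_sqrt // (lt_trans _ rs1).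
have th2 : theta ^+ 2 * sigma = r.
  rewrite sqr_sqrtr ?divfK ?gt_eqF //.
  by apply: ltW; apply: lt_trans rs1.
have [C C0 [N hC]] := cpow_shift_le H0 P0 ratioH convH sumH th1.
pose e k := rho ^+ m / rho ^+ (a * m) * (k%:R * coef_mod k * sigma ^+ k.-1).
pose B k := C / rho ^+ (a * m) * (f k * r ^+ k).
have r0 : 0 < r by apply: lt_trans sigma_r.
have ram : 0 < rho ^+ (a * m) by rewrite exprn_gt0.
have powE k : k == a %[mod D] ->
    rho ^+ (k * m) = rho ^+ (a * m) * P ^+ period_shift k.
  by move=> ka; rewrite (period_shiftE ka) exprD [rho ^+ (d * _)]exprM.
have Te0 : forall k n, 0 <= T k n.
  by move=> k n; rewrite mulr_ge0 //; case: ifP => // _; rewrite cpow_ge0.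
have Te : forall k eps, 0 < eps ->
    \forall n \near \oo, T k n <= (e k + eps) * H n.
  move=> k eps' e0'; rewrite /T /e /coef_mod.
  case ka: (k == a %[mod D]) => /=; last first.
    apply: nearW => n; rewrite !mulr0 mul0r mulr0 add0r.
    by rewrite mulr_ge0 // ltW.
  (* The summand 1 is there because [f k] may be 0. *)
  have den : 0 < 1 + f k by rewrite ltr_wpDr.
  have e1 : 0 < eps' / (1 + f k) by rewrite divr_gt0.
  have := cpow_shift_limsup H0 P0 ratioH convH sumH k (period_shift k) e1.
  apply: filterS => n hn; case: ifP => _; last first.
    rewrite mulr0 mulr_ge0 // addr_ge0 ?(ltW e0') //.
    by rewrite !mulr_ge0 ?invr_ge0 ?exprn_ge0 // ltW.
  apply: le_trans (ler_wpM2l (f0 k) hn) _; rewrite [leLHS]mulrA.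
  apply: ler_wpM2r => //.
  rewrite mulrDr lerD //.
    rewrite le_eqVlt; apply/orP; left; apply/eqP.
    case: (k) ka => [|j] ka; first by rewrite !mul0r !mulr0.
    rewrite -[j.+1.-1]/j /sigma exprMn -[rho ^+ m ^+ j]exprM.
    have := powE _ ka; rewrite mulSn exprD [(j * m)%N]mulnC => e'.
    have -> : P ^+ period_shift j.+1 = rho ^+ m * rho ^+ (m * j) / rho ^+ (a * m).
      by rewrite e' mulrC mulKf.
    by field.
  by rewrite mulrA ler_pdivrMr // mulrC ler_pM2l // lerDr.
have B0 k : 0 <= B k.
  by rewrite !mulr_ge0 ?invr_ge0 ?exprn_ge0 // ltW.
have TB : forall k n, (N <= n)%N -> T k n <= B k * H n.
  move=> k n Nn; rewrite /T /B; case: ifP => [/andP[ka tn]|_]; last first.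
    by rewrite mulr0 !mulr_ge0 ?invr_ge0 ?exprn_ge0 // ltW.
  apply: le_trans (ler_wpM2l (f0 k) (hC k _ n Nn tn)) _.
  have key : (theta * S) ^+ k * (theta * P) ^+ period_shift k <=
      r ^+ k / rho ^+ (a * m).
    have -> : (theta * S) ^+ k * (theta * P) ^+ period_shift k =
        theta ^+ (k + period_shift k) * (sigma ^+ k / rho ^+ (a * m)).
      rewrite /sigma !exprMn -[rho ^+ m ^+ k]exprM [(m * k)%N]mulnC powE // exprD.
      by field.
    have -> : r ^+ k / rho ^+ (a * m) =
        theta ^+ (2 * k) * (sigma ^+ k / rho ^+ (a * m)).
      by rewrite -{1}th2 exprMn -[theta ^+ 2 ^+ k]exprM mulrA.
    apply: ler_wpM2r.
      by apply: divr_ge0; apply/exprn_ge0/ltW.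
    by rewrite ler_weXn2l ?(ltW th1) // mul2n -addnn leq_add2l period_shift_le.
  have c0 : 0 <= f k * C * H n by rewrite !mulr_ge0.
  have := ler_wpM2l c0 key; set X := _ * _ ^+ period_shift k.
  rewrite (_ : f k * C * H n * X = f k * (C * X * H n)); last by ring.
  by move/le_trans; apply; rewrite le_eqVlt; apply/orP; left; apply/eqP; field.
have Bcv : cvgn (series B).
  exact: is_cvg_seriesZ.
have eL K : \sum_(k < K) e k <= rho ^+ m / rho ^+ (a * m) * Lam.
  rewrite -mulr_sumr; apply: ler_wpM2l.
    by rewrite divr_ge0 // exprn_ge0 // ltW.
  rewrite -(big_mkord xpredT (fun k => k%:R * coef_mod k * sigma ^+ k.-1)).
  apply: (nondecreasing_cvgn_le _ derivative_series_cvg).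
  apply/nondecreasing_seqP => k; rewrite /series /= big_nat_recr //= lerDl.
  by rewrite !mulr_ge0 ?exprn_ge0 ?(ltW sigma0) // /coef_mod; case: ifP.
have := dominated_limsup H0 Te0 Te B0 TB Bcv eL e0.
apply: filterS => n /(_ (a * m + d * n).+1); apply: le_trans.
by apply: ler_sum => k _; rewrite cpow_period.
Qed.
End CompositionCoefficients.

(** * Convergence in total variation *)

Section Scheffe.
Variables (R : realType) (I : choiceType) (X T : Type) (FF : set_system T).
Hypothesis FFF : Filter FF.
Variables (p : I -> R) (x : I -> X) (Q : T -> set X -> R).
Hypothesis p0 : forall i, 0 <= p i.
Hypothesis p_le1 : forall s : seq I, uniq s -> \sum_(i <- s) p i <= 1.
Hypothesis p_tight : forall eps, 0 < eps ->
  exists2 s : seq I, uniq s & 1 - eps <= \sum_(i <- s) p i.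
Hypothesis QC : forall t E, Q t E + Q t (~` E) <= 1.
Hypothesis Qsum : forall t E (s : seq I), uniq s ->
  \sum_(i <- s | `[< E (x i) >]) Q t [set x i] <= Q t E.
Hypothesis Qpoint : forall i eps, 0 < eps ->
  \forall t \near FF, p i - eps <= Q t [set x i].

Lemma near_seq (A : I -> T -> Prop) (s : seq I) :
  (forall i, \forall t \near FF, A i t) ->
  \forall t \near FF, forall i, i \in s -> A i t.
Proof.
move=> hA; elim: s => [|i s IH]; first exact: nearW.
apply: filterS2 (hA i) IH => t Ai As j; rewrite inE => /orP[/eqP ->//|].
exact: As.
Qed.

(** Pointwise lower bounds on a finite set carrying almost all the mass bound [Q t E] from below;
    the same applied to the complement of [E], with [QC], bounds it from above. Neither the set nor
    the error depends on [E]. *)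
Lemma scheffe eps : 0 < eps -> \forall t \near FF, forall E : set X,
  (`|(Q t E)%:E - \esum_(i in x @^-1` E) (p i)%:E| <= eps%:E)%E.
Proof.
move=> eps0; pose del := eps / 2; have del0 : 0 < del by rewrite divr_gt0.
have [s us ps] := p_tight del0.
pose eta := del / (size s).+1%:R; have eta0 : 0 < eta by rewrite divr_gt0.
have szeta : (size s)%:R * eta <= del.
  by rewrite /eta mulrCA ler_piMr ?(ltW del0) // ler_pdivrMr // mul1r ler_nat.
have := near_seq s (fun i => Qpoint i eta0); apply: filterS => t ht E.
have low (B : set X) : \sum_(i <- s | `[< B (x i) >]) p i - del <= Q t B.
  apply: le_trans (Qsum t B us); rewrite lerBlDr.
  apply: (@le_trans _ _ (\sum_(i <- s | `[< B (x i) >]) (Q t [set x i] + eta))).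
    rewrite big_seq_cond [leRHS]big_seq_cond; apply: ler_sum => i /andP[is_ _].
    by rewrite -lerBlDr ht.
  rewrite big_split /= lerD2l; apply: le_trans szeta.
  apply: (@le_trans _ _ (\sum_(i <- s) eta)).
    by rewrite big_mkcond /=; apply: ler_sum => i _; case: ifP => // _; exact: ltW.
  by rewrite big_const_seq count_predT iter_addr_0 mulr_natl.
have cover (B : set X) : \sum_(i <- s | `[< B (x i) >]) p i +
    \sum_(i <- s | `[< (~` B) (x i) >]) p i = \sum_(i <- s) p i.
  rewrite [RHS](bigID (fun i => `[< B (x i) >])) /=; congr (_ + _).
  by apply: eq_bigl => i; rewrite asbool_neg.
have lowE := low E; have lowC := low (~` E); have QE := QC t E.
have covE := cover E.
set SE := \sum_(i <- s | `[< E (x i) >]) p i in lowE covE *.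
set SC := \sum_(i <- s | _) p i in lowC covE *.
have esum_low : (SE%:E <= \esum_(i in x @^-1` E) (p i)%:E)%E.
  apply: esum_ge; exists [set` [seq i <- s | `[< E (x i) >]]].
    split; first exact: finite_seq.
    by move=> i /=; rewrite mem_filter => /andP[/asboolP].
  by rewrite -fsbig_seq ?filter_uniq // sumEFin lee_fin big_filter.
have esum_up : (\esum_(i in x @^-1` E) (p i)%:E <= (SE + del)%:E)%E.
  apply: ge_ereal_sup => _ [A [/finite_seqP[l0 ->] lE] <-].
  have -> : [set` l0] = [set` undup l0].
    by apply/seteqP; split=> i /=; rewrite mem_undup.
  rewrite -fsbig_seq ?undup_uniq // sumEFin lee_fin.
  (* A finite list inside [E] and the part of [s] outside [E] are disjoint, so together they have
     mass at most 1, while [s] alone already has [1 - del]. *)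
  have : \sum_(i <- undup l0 ++ [seq i <- s | `[< (~` E) (x i) >]]) p i <= 1.
    apply: p_le1; rewrite cat_uniq undup_uniq filter_uniq // andbT /=.
    apply/hasPn => i; rewrite mem_filter mem_undup => /andP[/asboolP nE _].
    by apply/negP => il; apply: nE; exact: lE.
  rewrite big_cat big_filter /= -/SC; lra.
have fin : \esum_(i in x @^-1` E) (p i)%:E =
    (fine (\esum_(i in x @^-1` E) (p i)%:E))%:E.
  rewrite fineK // fin_numE; apply/andP; split; apply/negP => /eqP e.
    by move: esum_low; rewrite e leeNy_eq.
  by move: esum_up; rewrite e leye_eq.
rewrite fin in esum_low esum_up *; rewrite -EFinB abse_EFin lee_fin ler_norml.
move: esum_low esum_up; rewrite !lee_fin => lo up.
have : eps = del + del by rewrite /del -splitr.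
move: (fine _) lo up => v lo up ->.
by apply/andP; split; lra.
Qed.
End Scheffe.

(** * Structures over the restricted species as structures over the full one *)

Section RestrictionInclusion.
Variables (R : realType) (F G : wspecies R) (D a : nat).

Lemma comp_mk_inj (F' : wspecies R) (U : finType) (P : {set {set U}})
    (PU PU' : finset.partition P [set: U]%SET) (y y' : F' (elts P))
    (g g' : forall Q : elts P, G (elts (sval Q))) :
  comp_mk (F := F') PU y g = comp_mk PU' y' g' -> y = y' /\ forall Q, g Q = g' Q.
Proof.
rewrite (Prop_irrelevance PU' PU) => e.
have {}e : existT (fun P0 : setpart U => comp_on F' G (sval P0))
    (exist _ P PU) (y, finfun g) = existT _ (exist _ P PU) (y', finfun g') := e.
have {}e : (y, finfun g) = (y', finfun g') := existT_inj2 e.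
split; first exact: (congr1 (@fst _ _) e).
have eg : finfun g = finfun g' := congr1 (@snd _ _) e.
by move=> Q; move/ffunP/(_ Q): eg; rewrite !ffunE.
Qed.

Definition restr_comp_incl (U : finType)
    (S : comp_structs (species_deriv (species_restr F D a)) G U) :
    comp_structs (species_deriv F) G U :=
  comp_mk (F := species_deriv F) (blocksP S) (sval (outer S)) (@component _ _ _ _ S).

Lemma restr_comp_incl_inj U : injective (@restr_comp_incl U).
Proof.
move=> [[P PP] [y g]] [[P' PP'] [y' g']]; rewrite /restr_comp_incl => e.
have eP : P = P' := congr1 (@blocks _ _ _ _) e; subst P'.
have ePP : PP' = PP by exact: Prop_irrelevance.
have [ey eg] := @comp_mk_inj (species_deriv F) U P _ _ (sval y) (sval y')
  (fun Q => g Q) (fun Q => g' Q) e.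
rewrite ePP (val_inj ey) (_ : g = g') //.
exact/ffunP.
Qed.

Lemma restr_incl_inj : injective (@restr_incl R F G D a).
Proof.
move=> [n S] [n' S'] e.
have en : n = n' := congr1 tag e; subst n'.
have eS : restr_comp_incl S = restr_comp_incl S' := existT_inj2 e.
by rewrite (restr_comp_incl_inj eS).
Qed.

Lemma comp_weight_mk (F' : wspecies R) (U : finType) (P : {set {set U}})
    (PU : finset.partition P [set: U]%SET) (y : F' (elts P))
    (g : forall Q : elts P, G (elts (sval Q))) :
  comp_weight (comp_mk PU y g) = weight F' y * \prod_Q weight G (g Q).
Proof.
rewrite /comp_weight; congr (_ * _).
by apply: eq_bigr => Q _; rewrite component_mk.
Qed.

Lemma weight_restr_comp_incl (U : finType)
    (S : comp_structs (species_deriv (species_restr F D a)) G U) :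
  comp_weight (restr_comp_incl S) = comp_weight S.
Proof. exact: comp_weight_mk. Qed.
End RestrictionInclusion.

(** One positive coefficient of a power, at [i], makes all large coefficients of the next power
    positive through the product with [H (n - i)]. *)
Lemma near_cpow_gt0 (R : realType) (H : nat -> R) (k : nat) :
  (forall n, 0 <= H n) -> (\forall n \near \oo, 0 < H n) -> (0 < k)%N ->
  \forall n \near \oo, 0 < cpow H k n.
Proof.
move=> H0 Hpos; case: k => // k _.
have step j i : 0 < cpow H j i -> \forall n \near \oo, 0 < cpow H j.+1 n.
  move=> ji; near=> n.
  have iLn : (i <= n)%N by near: n; exact: nbhs_infty_ge.
  rewrite cpowS (bigD1 (Ordinal (iLn : (i < n.+1)%N))) //=.
  rewrite ltr_wpDr ?mulr_gt0 //.
    by apply: sumr_ge0 => l _; rewrite mulr_ge0 ?cpow_ge0.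
  by near: n; exact: (cvg_subnr i _ Hpos).
suff [i ki] : exists i, 0 < cpow H k i by exact: step ki.
elim: k => [|k [i ki]]; first by exists 0%N; rewrite /= ltr01.
by have [N _ /(_ N (leqnn N)) hN] := step _ _ ki; exists N.
Unshelve. all: by end_near. Qed.

Lemma near_within_mod (d c : nat) (A : nat -> Prop) : (0 < d)%N ->
  (\forall n \near \oo, A (c + d * n)%N) ->
  \forall n \near within [set n | (n = c %[mod d])%N] \oo, A n.
Proof.
move=> d0 [N _ hN]; exists (c + d * N)%N => // n /= Nn nc.
have cn : (c <= n)%N by apply: leq_trans Nn; rewrite leq_addr.
have dvd : (d %| n - c)%N by rewrite -eqn_mod_dvd //; apply/eqP.
have nE : n = (c + d * ((n - c) %/ d))%N by rewrite mulnC divnK // subnKC.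
rewrite nE; apply: hN => /=; rewrite -(leq_pmul2l d0) -(leq_add2l c).
by rewrite -nE.
Qed.

(** * Summation over structures by size *)

Section SizedStructures.
Variables (R : realType) (F : wspecies R).

(** These lists exhaust the countable set of structures, and sums over them are partial sums of the
    generating series. *)
Definition structs_below N : seq (all_structs F) :=
  [seq existT (fun n => F 'I_n) n x | n <- iota 0 N, x <- enum (F 'I_n)].

Lemma mem_structs_below N r : (r \in structs_below N) = (tag r < N)%N.
Proof.
apply/allpairsPdep/idP => [[n [x [+ _ ->]]]|rN] /=; first by rewrite mem_iota.
exists (tag r), (tagged r); rewrite mem_iota mem_enum rN; split=> //.
by case: r {rN}.
Qed.

Lemma structs_below_uniq N : uniq (structs_below N).
Proof.
apply: allpairs_uniq_dep; first exact: iota_uniq.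
  by move=> n _; exact: enum_uniq.
by move=> [n x] [n' x'] _ _ /=.
Qed.

Lemma sum_structs_below (u : nat -> R) N :
  \sum_(r <- structs_below N) weight F (tagged r) * (u (tag r) / (tag r)`!%:R) =
  \sum_(n < N) egs F n * u n.
Proof.
rewrite big_allpairs_dep -{1}[N]subn0 -/(index_iota 0 N) big_mkord.
apply: eq_bigr => n _; rewrite /egs /= mulrAC -mulrA mulr_suml big_enum /=.
exact: eq_bigr.
Qed.

Lemma sum_le_structs_below (p : all_structs F -> R) (s : seq (all_structs F)) :
  (forall r, 0 <= p r) -> uniq s ->
  exists N, \sum_(r <- s) p r <= \sum_(r <- structs_below N) p r.
Proof.
move=> p0 us; pose N := (\max_(r <- s) tag r).+1; exists N.
have sN : {subset s <= structs_below N}.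
  by move=> r rs; rewrite mem_structs_below ltnS (leq_bigmax_seq _ rs).
rewrite (perm_big [seq r <- structs_below N | r \in s]); last first.
  apply: uniq_perm; rewrite ?filter_uniq ?structs_below_uniq // => r.
  by rewrite mem_filter; case: (boolP (r \in s)) => // /sN ->.
by rewrite big_filter big_mkcond; apply: ler_sum => r _; case: ifP.
Qed.
End SizedStructures.

Lemma dTV_cvg0 (R : realType) (X T : Type) (FF : set_system T)
    (FFF : ProperFilter FF) (P Q : T -> set X -> \bar R) :
  (forall eps, 0 < eps -> \forall t \near FF, forall E : set X,
     (`|P t E - Q t E| <= eps%:E)%E) ->
  dTV (P t) (Q t) @[t --> FF] --> 0%E.
Proof.
move=> PQ.
have dge0 t : (0 <= dTV (P t) (Q t))%E.
  apply: (@le_trans _ _ `|P t set0 - Q t set0|%E); first exact: abse_ge0.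
  by apply: ereal_sup_ubound; exists set0.
have dle eps : 0 < eps -> \forall t \near FF, (dTV (P t) (Q t) <= eps%:E)%E.
  move=> /PQ; apply: filterS => t h; apply: ge_ereal_sup => _ [E _ <-].
  exact: h.
have fin t eps : (dTV (P t) (Q t) <= eps%:E)%E -> dTV (P t) (Q t) \is a fin_num.
  by move=> le; rewrite ge0_fin_numE // (le_lt_trans le) ?ltry.
apply/fine_cvgP; split; first by apply: filterS (dle 1 ltr01) => t; exact: fin.
apply/cvgrPdist_le => eps /dle; apply: filterS => t le /=.
rewrite sub0r normrN ger0_norm ?fine_ge0 //.
by rewrite -lee_fin fineK ?(fin _ _ le).
Qed.

(** * The Boltzmann limit of the remainder *)

Section Assembly.
Variables (R : realType) (F G : wspecies R) (d m a : nat).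
Variables (h : nat -> R) (rho : R).
Hypothesis G0 : #|G 'I_0| = 0%N.
Hypothesis d0 : (0 < d)%N.
Hypothesis md : (m < d)%N.
Hypothesis gh : is_divXn m (egs G) h.
Hypothesis hS : classS d h.
Hypothesis cG : cvradius (egs G) = rho%:E.
Hypothesis sub : (ps_eval (egs G) rho < cvradius (egs F))%E.
Let D := (d %/ gcdn m d)%N.
Hypothesis aD : (a < D)%N.
Hypothesis Fa_nc : ~ is_constant (egs (species_restr F D a)).

Let H n := h (d * n)%N.
Let S := fine (ps_eval h rho).
Let sigma := rho ^+ m * S.
Let e k := k%:R * coef_mod (egs F) d m a k * sigma ^+ k.-1.
Let Lam := limn (series e).
Let XR := all_structs (species_comp (species_deriv (species_restr F D a)) G).
Let Z n := egs (species_comp F G) n.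

Let hfacts := classS_dilate d0 hS (etrans (cvradius_divXn gh) cG).
Let rho0 : 0 < rho. Proof. by case: hfacts => -[]. Qed.
Let h0 n : 0 <= h n. Proof. by case: hfacts => -[]. Qed.
Let hd n : ~~ (d %| n)%N -> h n = 0. Proof. by case: hfacts => -[_ _ hd0] _; exact: hd0. Qed.
Let H0 n : 0 <= H n. Proof. exact: h0. Qed.
Let P0 : 0 < rho ^+ d. Proof. exact: exprn_gt0. Qed.
Let ratioH : H n / H n.+1 @[n --> \oo] --> rho ^+ d.
Proof. by case: hfacts => _ []. Qed.
Let convH :
  (H n)^-1 * (\sum_(i < n.+1) H i * H (n - i)%N) @[n --> \oo] --> 2 * S.
Proof. by case: hfacts => _ []. Qed.
Let sumH : \sum_(i < n) H i * (rho ^+ d) ^+ i @[n --> \oo] --> S.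
Proof. by case: hfacts => _ []. Qed.

Let g00 : egs G 0 = 0.
Proof.
rewrite /egs big1 ?mul0r // => x _; have := card0_eq G0 x.
by rewrite inE.
Qed.

Let sumg : \sum_(i < n) egs G i * rho ^+ i @[n --> \oo] --> sigma.
Proof.
rewrite -(cvg_shiftn m).
have : rho ^+ m * (\sum_(i < n) h i * rho ^+ i) @[n --> \oo] --> sigma.
  by apply: cvgMl_tmp; case: hfacts => _ [].
apply: cvg_trans; apply: near_eq_cvg; apply: nearW => n.
by rewrite /= addnC (divXn_sum _ _ gh).
Qed.

Let ps_eval_G : ps_eval (egs G) rho = sigma%:E.
Proof. exact: ps_evalE sumg. Qed.

Let larger_radius :
  exists2 r, sigma < r & cvgn (series (fun k => egs F k * r ^+ k)).
Proof.
move: sub; rewrite ps_eval_G => /ereal_sup_gt[_ [r [_ cv] <-]].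
by rewrite lte_fin => sr; exists r.
Qed.

Let sigma_gt0 : 0 < sigma.
Proof. by rewrite mulr_gt0 ?exprn_gt0 // (mass_gt0 H0 P0 ratioH sumH). Qed.

Let e_ge0 k : 0 <= e k.
Proof.
rewrite !mulr_ge0 ?exprn_ge0 ?(ltW sigma_gt0) // /coef_mod.
by case: ifP => // _; exact: egs_ge0.
Qed.

Let e_cvg : cvgn (series e).
Proof.
have [r sr cv] := larger_radius.
exact: (derivative_series_cvg (egs_ge0 F) rho0 h0 ratioH sumH sr cv).
Qed.

Let coef_modE k : egs (species_restr F D a) k = coef_mod (egs F) d m a k.
Proof. exact: egs_restr. Qed.

(** Here non-constancy of [F_a] enters; the coefficient found makes [Lam] positive, so that the
    Boltzmann distribution can be normalised. *)
Let ex_coef : exists2 k, (0 < k)%N & 0 < coef_mod (egs F) d m a k.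
Proof.
apply: contrapT => no; apply: Fa_nc.
exists (egs (species_restr F D a) 0) => k; rewrite coefC coef_modE.
case: k => [|k] //=; apply/eqP; rewrite eq_le leNgt.
apply/andP; split; first by apply/negP => lt; apply: no; exists k.+1.
by rewrite /coef_mod; case: ifP => // _; exact: egs_ge0.
Qed.

Lemma Lam_gt0 : 0 < Lam.
Proof.
have [k k0 ek] := ex_coef.
apply: (@lt_le_trans _ _ (series e k.+1)).
  rewrite /series /= big_nat_recr //= ltr_wpDl ?sumr_ge0 //.
  by rewrite /e !mulr_gt0 ?exprn_gt0 // ltr0n.
apply: nondecreasing_cvgn_le e_cvg _; apply/nondecreasing_seqP => n.
by rewrite /series /= [leRHS]big_nat_recr //= lerDl.
Qed.

Let derivative_cvg :
  \sum_(k < n) egs (species_deriv (species_restr F D a)) k * sigma ^+ k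
    @[n --> \oo] --> Lam.
Proof.
have : series e n.+1 @[n --> \oo] --> Lam by rewrite (cvg_shiftS (series e)).
apply: cvg_trans; apply: near_eq_cvg; apply: nearW => n.
rewrite /series /= big_mkord big_ord_recl /= /e mul0r mul0r add0r.
by apply: eq_bigr => k _; rewrite egs_deriv coef_modE.
Qed.

Let boltzmannE (r : XR) : boltzmann rho r =
  comp_weight (tagged r) * (rho ^+ tag r / (tag r)`!%:R) * Lam^-1.
Proof. by rewrite /boltzmann ps_eval_G -[fine sigma%:E]/sigma (ps_evalE derivative_cvg). Qed.

(** Substitution at [rho] for [F_a'] and [G]: it shows that the Boltzmann weights, normalised by
    [Lam], have total mass exactly 1. *)
Let total_mass :
  \sum_(n < N) egs (species_comp (species_deriv (species_restr F D a)) G) n *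
    rho ^+ n @[N --> \oo] --> Lam.
Proof.
have := subst_sum_cvg (egs_ge0 _) (egs_ge0 _) g00 (ltW rho0) sumg derivative_cvg.
apply: cvg_trans; apply: near_eq_cvg; apply: nearW => N.
by apply: eq_bigr => n _; rewrite egs_species_comp.
Qed.

Let boltzmann_ge0 (r : XR) : 0 <= boltzmann rho r.
Proof.
rewrite boltzmannE mulr_ge0 ?invr_ge0 ?(ltW Lam_gt0) // mulr_ge0 //.
  exact: comp_weight_ge0.
by rewrite divr_ge0 // exprn_ge0 // ltW.
Qed.

Let sum_boltzmann N : \sum_(r <- structs_below
    (species_comp (species_deriv (species_restr F D a)) G) N) boltzmann rho r =
  (\sum_(n < N) egs (species_comp (species_deriv (species_restr F D a)) G) n *
    rho ^+ n) / Lam.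
Proof.
by rewrite -sum_structs_below mulr_suml; apply: eq_bigr => r _; rewrite boltzmannE.
Qed.

Lemma boltzmann_le1 (s : seq XR) : uniq s -> \sum_(r <- s) boltzmann rho r <= 1.
Proof.
move=> us; have [N] := sum_le_structs_below boltzmann_ge0 us.
move/le_trans; apply; rewrite sum_boltzmann ler_pdivrMr ?Lam_gt0 // mul1r.
rewrite -(cvg_lim (@Rhausdorff R) total_mass).
apply: (@nondecreasing_cvgn_le _ (fun N => \sum_(n < N) _)); last first.
  by apply/cvg_ex; exists Lam; exact: total_mass.
apply/nondecreasing_seqP => n; rewrite big_ord_recr /= lerDl.
by rewrite mulr_ge0 ?egs_ge0 // exprn_ge0 // ltW.
Qed.

Lemma boltzmann_tight eps : 0 < eps ->
  exists2 s : seq XR, uniq s & 1 - eps <= \sum_(r <- s) boltzmann rho r.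
Proof.
move=> e0; have lt : Lam - eps * Lam < Lam by rewrite ltrBlDr ltrDl mulr_gt0 ?Lam_gt0.
have [N _ /(_ N (leqnn N)) hN] : \forall N \near \oo, Lam - eps * Lam <
    \sum_(n < N) egs (species_comp (species_deriv (species_restr F D a)) G) n *
      rho ^+ n.
  by apply: (cvgr_gt Lam) lt; exact: total_mass.
exists (structs_below _ N); first exact: structs_below_uniq.
rewrite sum_boltzmann ler_pdivlMr ?Lam_gt0 // mulrBl mul1r; exact: ltW.
Qed.
Lemma near_total_gt0 : \forall n \near \oo, 0 < Z (a * m + d * n).
Proof.
have [k k0] := ex_coef; rewrite /coef_mod; case: ifP => [ka fk|]; last by rewrite ltxx.
have Hk := near_cpow_gt0 H0 (near_coef_gt0 H0 P0 ratioH) k0.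
near=> n; rewrite /Z egs_species_comp //.
have kn : (k < (a * m + d * n).+1)%N.
  have nk : (k <= n)%N by near: n; exact: nbhs_infty_ge.
  by rewrite ltnS (leq_trans nk) // (leq_trans _ (leq_addl _ _)) // leq_pmull.
rewrite (bigD1 (Ordinal kn)) //= ltr_wpDr //.
  by apply: sumr_ge0 => i _; rewrite mulr_ge0 ?cpow_ge0 //; apply: egs_ge0.
rewrite mulr_gt0 // (cpow_period d0 aD gh hd) ka /= ifT; last first.
  by near: n; exact: nbhs_infty_ge.
by near: n; exact: (cvg_subnr _ _ Hk).
Unshelve. all: by end_near. Qed.

(** A remainder of non-zero weight forces some [k] with [k + 1] congruent to [a] modulo [D] such
    that [[z^|r|] G^k] is non-zero. Hence [|r| + m] is congruent to [(k + 1) m], thus to [a m],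
    modulo [d], and the deleted block has a size in the progression supporting [G]. *)
Let size_period (r : XR) : comp_weight (tagged r) != 0 ->
  exists t, (tag r + m = a * m + d * t)%N.
Proof.
case: r => n S0 /= S0n0; pose FaG := species_comp (species_deriv (species_restr F D a)) G.
have en0 : egs FaG n != 0.
  apply: contra S0n0 => /eqP en; apply/eqP.
  have := sum_weight_egs FaG 'I_n; rewrite card_ord en mul0r => /psumr_eq0P.
  by apply=> // S' _; exact: weight_ge0.
have [k _ /eqP] : exists2 k : 'I_n.+1, true &
    egs (species_deriv (species_restr F D a)) k * cpow (egs G) k n <> 0.
  apply: contrapT => no; move/eqP: en0; apply; rewrite egs_species_comp // big1 //.
  by move=> k _; apply: contrapT => ne; apply: no; exists k.
rewrite mulf_eq0 negb_or egs_deriv coef_modE mulf_eq0 negb_or.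
rewrite /coef_mod => /andP[/andP[_]]; case: ifP => [ka _|_ /eqP//].
have [gm hg] := gh; rewrite (cpow_shift k n gm hg).
case: ifP => [_ /eqP//|/negbT]; rewrite -leqNgt => kmn.
rewrite (cpow_dilate k _ d0 hd); case: ifP => [dvd _|_ /eqP//].
exists (period_shift d m a k.+1 + (n - k * m) %/ d)%N.
rewrite mulnDr addnA -period_shiftE // [(d * (_ %/ d))%N]mulnC divnK //.
by rewrite mulSn -addnA subnKC // addnC.
Qed.

Lemma boltzmann_le_remainder_prob (r : XR) eps : 0 < eps ->
  \forall n \near \oo,
    boltzmann rho r - eps <=
      remainder_prob (a * m + d * n) [set restr_incl r].
Proof.
(* For weight 0 the bound is trivial, and the size of [r] need not lie in the right class. *)
move=> e0; have [w0|wn0] := eqVneq (comp_weight (tagged r)) 0.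
  apply: nearW => n; rewrite boltzmannE w0 !mul0r sub0r.
  apply: (@le_trans _ _ 0); first by rewrite oppr_le0 ltW.
  exact: remainder_prob_ge0.
have [t tE] := size_period wn0.
have nz i : rho ^+ i != 0 by rewrite expf_neq0 // gt_eqF.
pose w := comp_weight (tagged r) / (tag r)`!%:R.
have w0 : 0 <= w by rewrite divr_ge0 // comp_weight_ge0.
pose A := rho ^+ m / rho ^+ (a * m) * Lam.
have A0 : 0 < A by rewrite mulr_gt0 ?Lam_gt0 // divr_gt0 ?exprn_gt0.
pose q := (rho ^+ d) ^+ t; have q0 : 0 < q by rewrite exprn_gt0.
have bE : boltzmann rho r = w * q / A.
  have qE : q = rho ^+ tag r * rho ^+ m / rho ^+ (a * m).
    by rewrite -exprD tE exprD mulrC mulKf // exprM.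
  have nf : (tag r)`!%:R != 0 :> R by rewrite pnatr_eq0 -lt0n fact_gt0.
  have L0 := gt_eqF Lam_gt0.
  by rewrite boltzmannE /w /A qE; field; rewrite nf L0 !nz.
(* With this value the total loss [w * del * (q + A) / A] equals [eps * A * (w / (w + 1))], which is
   at most [eps * A]. *)
pose del := eps * A ^+ 2 / ((w + 1) * (q + A)).
have w1 : 0 < w + 1 by rewrite ltr_wpDl.
have qA : 0 < q + A by rewrite addr_gt0.
have del0 : 0 < del.
  by apply: divr_gt0; apply: mulr_gt0 => //; exact: exprn_gt0.
have [rad sr cv] := larger_radius.
have Zle := composition_coef_limsup (egs_ge0 F) d0 md aD gh rho0 h0 hd ratioH
  convH sumH sr cv del0.
have Hle : \forall n \near \oo, q - del < H (n - t)%N / H n.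
  apply: (cvgr_gt q); first exact: shift_ratio_cvg.
  by rewrite ltrBlDr ltrDl.
near=> n.
have tn : (t <= n)%N by near: n; exact: nbhs_infty_ge.
have rn : (2 * tag r < n)%N by near: n; exact: nbhs_infty_gt.
have Hn : 0 < H n by near: n; exact: near_coef_gt0 ratioH.
have Zn : 0 < Z (a * m + d * n) by near: n; exact: near_total_gt0.
have Znle : Z (a * m + d * n) <= (A + del) * H n.
  by rewrite /Z egs_species_comp //; near: n.
have Hnle : q - del <= H (n - t)%N / H n by apply: ltW; near: n.
have rN : (2 * tag r < a * m + d * n)%N.
  by apply: leq_trans rn _; rewrite (leq_trans _ (leq_addl _ _)) // leq_pmull.
have := @remainder_prob_point R F G (a * m + d * n) (restr_incl r) rN.
apply: le_trans.
have -> : weight (species_comp (species_deriv F) G) (tagged (restr_incl r)) =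
    comp_weight (tagged r) := weight_restr_comp_incl (tagged r).
have -> : tag (restr_incl r) = tag r by [].
(* In this form the coefficient of [G] at the size of the deleted block is [H (n - t)]. *)
have -> : (a * m + d * n - tag r = d * (n - t) + m)%N.
  have -> : (a * m + d * n = tag r + (d * (n - t) + m))%N.
    by rewrite -{1}(subnKC tn) mulnDr addnA -tE -addnA [(m + _)%N]addnC.
  by rewrite addKn.
rewrite -(proj2 gh) -/w -/(H _) -/(Z _) bE.
apply: (@le_trans _ _ (w * (q - del) / (A + del))).
  rewrite ler_pdivlMr ?addr_gt0 // mulrBl mulrDr.
  have -> : w * q / A * A = w * q by rewrite divfK // gt_eqF.
  have dA : w * q / A * del <= eps * A - w * del.
    rewrite lerBrDr.
    rewrite [leLHS](_ : _ = eps * A * (w / (w + 1))); last first.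
      by rewrite /del; field; rewrite !gt_eqF.
    apply: ler_piMr; first by apply: mulr_ge0; exact: ltW.
    by rewrite ler_pdivrMr // mul1r lerDl.
  have : 0 <= eps * del by rewrite mulr_ge0 // ltW.
  have wq : w * (q - del) = w * q - w * del by rewrite mulrBr.
  rewrite wq; lra.
apply: (@le_trans _ _ (w * H (n - t)%N / ((A + del) * H n))).
  have Ad : 0 < A + del by rewrite addr_gt0.
  have -> : w * H (n - t)%N / ((A + del) * H n) =
      w * (H (n - t)%N / H n) / (A + del).
    by field; rewrite !gt_eqF.
  by apply: ler_wpM2r; [rewrite invr_ge0 ltW | exact: ler_wpM2l].
apply: ler_wpM2l; first exact: mulr_ge0.
have ? : 0 < (A + del) * H n by rewrite mulr_gt0 // addr_gt0.
by rewrite lef_pV2 ?posrE.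
Unshelve. all: by end_near. Qed.

Lemma remainder_dTV_cvg0 :
  dTV (@remainder_law R F G n) (@boltzmann_law R F G D a rho)
    @[n --> within [set n | (n = a * m %[mod d])%N] \oo] --> 0%E.
Proof.
have PF : ProperFilter (within [set n | (n = a * m %[mod d])%N] \oo).
  (* The residue class contains arbitrarily large integers, such as [a m + d N]. *)
  apply: Build_ProperFilter_ex => B [N _ hB].
  exists (a * m + d * N)%N; apply: hB => /=; last by rewrite addnC [(d * N)%N]mulnC modnMDl.
  by rewrite (leq_trans _ (leq_addl _ _)) // leq_pmull.
apply: dTV_cvg0 => eps e0.
have Qsum n (E : set (all_structs (species_comp (species_deriv F) G))) (s : seq XR) :
    uniq s -> \sum_(r <- s | `[< E (restr_incl r) >])
      remainder_prob n [set restr_incl r] <= remainder_prob n E.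
  by move=> us; apply: remainder_prob_sum => //; exact: restr_incl_inj.
have Qpoint (r : XR) eps' : 0 < eps' ->
    \forall n \near within [set n | (n = a * m %[mod d])%N] \oo,
      boltzmann rho r - eps' <= remainder_prob n [set restr_incl r].
  by move=> e0'; apply: near_within_mod => //; exact: boltzmann_le_remainder_prob.
exact: (scheffe _ boltzmann_le1 boltzmann_tight (@remainder_prob_setC R F G)
  Qsum Qpoint e0).
Qed.
End Assembly.

Theorem theorem3p4 (R : realType) (F G : wspecies R) (d m a : nat)
    (h : nat -> R) (rho : R) :
  #|G 'I_0| = 0%N ->
  (exists2 k, (0 < k)%N & 0 < egs F k) ->
  ~ is_polynomial (egs (species_comp F G)) ->
  (0 < d)%N -> (m < d)%N ->
  is_divXn m (egs G) h -> classS d h ->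
  cvradius (egs G) = rho%:E ->
  (ps_eval (egs G) rho < cvradius (egs F))%E ->
  let D := (d %/ gcdn m d)%N in
  (a < D)%N ->
  ~ is_constant (egs (species_restr F D a)) ->
  dTV (@remainder_law R F G n) (@boltzmann_law R F G D a rho)
    @[n --> within [set n | (n = a * m %[mod d])%N] \oo] --> 0%E.
Proof.
move=> G0 _ _ d0 md gh hS cG sub D aD Fa_nc.
exact: remainder_dTV_cvg0 gh hS cG sub aD Fa_nc.
Qed.
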